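(* (a) Fine shape is weaker than homotopy: there is a functor $\mathcal F$ from the homotopy category of metrizable spaces to the fine shape category which is the identity on objects, given on morphisms by $[\varphi]\mapsto[\varphi_{MN}]$. (b) For ANRs fine shape coincides with homotopy: if $X$ and $Y$ are ANRs, then $\mathcal F\colon [X,Y]\to[X,Y]_{\mathrm{Fish}}$ is a bijection. (c) For compacta (= compact metrizable spaces) fine shape coincides with strong shape: for all compacta $X$, $Y$ there is a bijection between the set $[X,Y]_{\mathrm{Fish}}$ of fine shape morphisms $X\to Y$ and the set of strong shape morphisms $X\to Y$, and these bijections respect composition of morphisms and identity morphisms.
   Context: Maps are continuous, $I=[0,1]$, $[X,Y]$ is the set of homotopy classes of maps $X\to Y$. Absolute retracts (ARs) and ANRs are those for metrizable spaces. A subset $X$ of an ANR $M$ is a Z-set if it is closed and there is a homotopy $h_t\colon M\to M$ with $h_0=\mathrm{id}$ and $h_t(M)\subset M\setminus X$ for $t>0$. Every metrizable space embeds as a Z-set in some AR. If $X\subset M$ and $Y\subset N$ are closed subsets of metrizable spaces, a map $f\colon M\setminus X\to N\setminus Y$ is $X$-$Y$-approaching if it sends every sequence having a cluster point in $X$ to a sequence having a cluster point in $Y$. An $X$-$Y$-approaching homotopy is a homotopy $(M\setminus X)\times I\to N\setminus Y$ that is an $(X\times I)$-$Y$-approaching map (with respect to $X\times I\subset M\times I$). Fine shape category. Its objects are metrizable spaces. If $X$, $Y$ are Z-sets in ARs $M$, $N$ and $\varphi\colon X\to Y$ is a map, $\varphi_{MN}\colon M\setminus X\to N\setminus Y$ denotes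 an $X$-$Y$-approaching map which combines with $\varphi$ into a continuous map $M\to N$; it exists and is unique up to $X$-$Y$-approaching homotopy. If $X$ is a Z-set in ARs $M,M'$ and $Y$ is a Z-set in ARs $N,N'$, then $X$-$Y$-approaching maps $\Phi\colon M\setminus X\to N\setminus Y$ and $\Phi'\colon M'\setminus X\to N'\setminus Y$ represent the same fine shape morphism $X\to Y$ if $(\mathrm{id}_Y)_{NN'}\Phi$ and $\Phi'(\mathrm{id}_X)_{MM'}$ are $X$-$Y$-approaching homotopic; fine shape morphisms $X\to Y$ are the classes of this equivalence relation, and they form the set $[X,Y]_{\mathrm{Fish}}$. Composition is induced by composition of representatives $M\setminus X\to N\setminus Y\to L\setminus Z$. Strong shape of compacta. For compacta $X$, $Y$ embedded as Z-sets in the Hilbert cube $I^\infty$, a strong shape morphism $X\to Y$ is a proper homotopy class of proper maps $I^\infty\setminus X\to I^\infty\setminus Y$ (this is independent of the embeddings up to canonical bijection), and composition is induced by composition of proper maps. (A map is proper if preimages of compact sets are compact; a proper homotopy is a homotopy that is a proper map.) *)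

(* Defs.v *)
From HB Require Import structures.
From mathcomp Require Import all_boot all_order all_algebra.
From mathcomp Require Import all_classical all_reals all_analysis.

Set Implicit Arguments.
Unset Strict Implicit.
Unset Printing Implicit Defensive.

Import Order.TTheory GRing.Theory Num.Theory.
Import numFieldNormedType.Exports.

Local Open Scope classical_set_scope.
Local Open Scope ring_scope.

(* The set of classes of E, meant for an equivalence relation. The classes are
   predicates T -> Prop rather than [set T]: T may be too large for the universe
   of [set]. *)
Definition quotient {T : Type} (E : T -> T -> Prop) : Type :=
  {A : T -> Prop | exists x, A = E x}.

Definition class {T : Type} (E : T -> T -> Prop) (x : T) : quotient E :=
  exist _ (E x) (ex_intro _ x erefl).

Record category_on (Ob : Type) (Hom : Ob -> Ob -> Type) := Category {
  id1 : forall X, Hom X X;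
  comp : forall X Y Z, Hom Y Z -> Hom X Y -> Hom X Z;
  comp1f : forall X Y (f : Hom X Y), comp (id1 Y) f = f;
  compf1 : forall X Y (f : Hom X Y), comp f (id1 X) = f;
  compA : forall W X Y Z (h : Hom Y Z) (g : Hom X Y) (f : Hom W X),
    comp h (comp g f) = comp (comp h g) f }.

Arguments id1 {Ob Hom} c X.
Arguments comp {Ob Hom} c {X Y Z} g f.

Definition pullback_cat (Ob Ob' : Type) (o : Ob' -> Ob) (Hom : Ob -> Ob -> Type)
    (C : category_on Hom) : category_on (fun X Y : Ob' => Hom (o X) (o Y)) :=
  {| id1 := fun X => id1 C (o X);
     comp := fun X Y Z g f => comp C g f;
     comp1f := fun X Y f => comp1f C f;
     compf1 := fun X Y f => compf1 C f;
     compA := fun W X Y Z h g f => compA C h g f |}.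

Definition functorial (Ob : Type) (Hom Hom' : Ob -> Ob -> Type)
    (C : category_on Hom) (C' : category_on Hom')
    (F : forall X Y, Hom X Y -> Hom' X Y) : Prop :=
  (forall X, F X X (id1 C X) = id1 C' X) /\
  (forall X Y Z (g : Hom Y Z) (f : Hom X Y),
     F X Z (comp C g f) = comp C' (F Y Z g) (F X Y f)).

Section topology.
Variable R : realType.

Definition homeomorphic (S T : topologicalType) : Prop :=
  exists (f : S -> T) (g : T -> S),
    [/\ continuous f, continuous g, cancel f g & cancel g f].

Definition metrizable (T : topologicalType) : Prop :=
  exists D : metricType R, homeomorphic T D.

Record metrizable_space := MetrizableSpace {
  mspace_sort :> topologicalType;
  metrizableP : metrizable mspace_sort }.

Definition embedding (S T : topologicalType) (e : S -> T) : Prop :=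
  injective e /\ forall U : set S, open U <-> exists2 V, open V & e @^-1` V = U.

(* The retraction is a self-map of Z, total even when M is empty. Thus the
   empty space is an ANR but not an AR. *)
Definition is_AR (M : metrizable_space) : Prop :=
  forall (Z : metrizable_space) (e : M -> Z),
    embedding e -> closed (range e) ->
    exists r : Z -> Z, [/\ continuous r, (forall z, range e (r z)) &
      (forall m, r (e m) = e m)].

Definition is_ANR (M : metrizable_space) : Prop :=
  forall (Z : metrizable_space) (e : M -> Z),
    embedding e -> closed (range e) ->
    exists (U : set Z) (r : Z -> Z),
      [/\ open U, range e `<=` U, {within U, continuous r},
          (forall z, U z -> range e (r z)) & (forall m, r (e m) = e m)].

(* Homotopies are functions on S * R, considered only on subsets D `*` [0, 1]. *)
Definition unit_itv : set R := `[0, 1]%classic.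

Definition is_Zset (M : topologicalType) (X : set M) : Prop :=
  closed X /\
  exists h : M * R -> M,
    [/\ {within setT `*` unit_itv, continuous h},
        (forall m, h (m, 0) = m) &
        (forall m t, 0 < t <= 1 -> ~ X (h (m, t)))].

Record Zembedding (X M : topologicalType) := ZEmbedding {
  zemb :> X -> M;
  zemb_embedding : embedding zemb;
  zemb_Zset : is_Zset (range zemb) }.

Definition homotopic (X Y : topologicalType) (f g : continuousType X Y) : Prop :=
  exists h : X * R -> Y,
    [/\ {within setT `*` unit_itv, continuous h},
        (forall x, h (x, 0) = f x) & (forall x, h (x, 1) = g x)].

Definition htpy_hom (X Y : metrizable_space) : Type :=
  quotient (@homotopic X Y).

Definition htpy_class (X Y : metrizable_space) (f : continuousType X Y) :
  htpy_hom X Y := class (@homotopic X Y) f.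

(* Every class has a representative, so [htpy_comp] determines the composition;
   that it is well defined is part of the existence of such a structure. The same
   applies to the two categories below, where for [fine_shape_category] one uses
   that two morphisms have representatives with a common middle AR. *)
Record homotopy_category := HomotopyCategory {
  htpy_cat :> category_on htpy_hom;
  htpy_id : forall X : metrizable_space,
    id1 htpy_cat X = htpy_class (@idfun X : continuousType X X);
  htpy_comp : forall (X Y Z : metrizable_space)
      (g : continuousType Y Z) (f : continuousType X Y),
    comp htpy_cat (htpy_class g) (htpy_class f) =
    htpy_class (g \o f : continuousType X Z) }.

(* A map from a subset D of S to the complement of B in T is given by a function
   S -> T, whose values outside D are irrelevant; "A-B-approaching" refers to
   sequences in D that have a cluster point in A. *)
Record approaching (S T : topologicalType) (D A : set S) (B : set T)
    (f : S -> T) : Prop := Approaching {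
  approaching_cts : {within D, continuous f};
  approaching_fun : forall x, D x -> ~ B (f x);
  approaching_cluster : forall u : nat -> S, (forall n, D (u n)) ->
    (exists2 a, A a & cluster (u @ \oo) a) ->
    exists2 b, B b & cluster ((f \o u) @ \oo) b }.

Record approaching_map (X M Y N : topologicalType)
    (eX : Zembedding X M) (eY : Zembedding Y N) := ApproachingMap {
  amap :> M -> N;
  amapP : approaching (~` range eX) (range eX) (range eY) amap }.

Definition approaching_homotopic (X M Y N : topologicalType)
    (eX : Zembedding X M) (eY : Zembedding Y N)
    (f g : approaching_map eX eY) : Prop :=
  exists h : M * R -> N,
    [/\ approaching (~` range eX `*` unit_itv) (range eX `*` unit_itv)
          (range eY) h,
        (forall m, ~ range eX m -> h (m, 0) = f m) &
        (forall m, ~ range eX m -> h (m, 1) = g m)].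

Lemma approaching_id (X M : topologicalType) (eX : Zembedding X M) :
  approaching (~` range eX) (range eX) (range eX) (@idfun M).
Proof.
by split=> //; apply: continuous_subspaceT => x; exact: cvg_id.
Qed.

Lemma within_comp (S T U : topologicalType) (A : set S) (B : set T)
    (f : S -> T) (g : T -> U) : (forall x, A x -> B (f x)) ->
  {within A, continuous f} -> {within B, continuous g} ->
  {within A, continuous (g \o f)}.
Proof.
move=> AB /subspace_sigL_continuousP cf /subspace_sigL_continuousP cg.
apply/subspace_sigL_continuousP.
have AB' (x : A) : f (set_val x) \in B.
  by rewrite inE; apply: AB; have := valP x; rewrite inE.
pose f' (x : A) : B := exist _ (f (set_val x)) (AB' x).
have cf' : continuous f' by apply/continuous_comp_initial.
move=> x; exact: (continuous_comp (cf' x) (cg (f' x))).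
Qed.

Lemma approaching_comp (X M Y N Z L : topologicalType) (eX : Zembedding X M)
    (eY : Zembedding Y N) (eZ : Zembedding Z L)
    (g : approaching_map eY eZ) (f : approaching_map eX eY) :
  approaching (~` range eX) (range eX) (range eZ) (g \o f).
Proof.
case: f g => [f [cf Df uf]] [g [cg Dg ug]]; split=> /=.
- exact: (within_comp Df cf cg).
- by move=> x /Df/Dg.
- by move=> u Du /(uf _ Du); apply: ug => n; exact: (Df _ (Du n)).
Qed.

Definition amap_id (X M : topologicalType) (eX : Zembedding X M) :
  approaching_map eX eX := ApproachingMap (approaching_id eX).

Definition amap_comp (X M Y N Z L : topologicalType) (eX : Zembedding X M)
    (eY : Zembedding Y N) (eZ : Zembedding Z L)
    (g : approaching_map eY eZ) (f : approaching_map eX eY) :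
  approaching_map eX eZ := ApproachingMap (approaching_comp g f).

(* f is a phi_MN; its values on X, being irrelevant, are replaced through phi. *)
Definition combines (X M Y N : topologicalType)
    (eX : Zembedding X M) (eY : Zembedding Y N)
    (phi : X -> Y) (f : approaching_map eX eY) : Prop :=
  exists F : M -> N,
    [/\ continuous F, (forall m, ~ range eX m -> F m = f m) &
        (forall x, F (eX x) = eY (phi x))].

Record AR_Zembedding (X : topologicalType) := ARZEmbedding {
  ar_space : metrizable_space;
  ar_spaceP : is_AR ar_space;
  ar_zemb :> Zembedding X ar_space }.

Record fish_rep (X Y : metrizable_space) := FishRep {
  fish_dom : AR_Zembedding X;
  fish_cod : AR_Zembedding Y;
  fish_map : approaching_map fish_dom fish_cod }.

Definition fish_equiv (X Y : metrizable_space) (p q : fish_rep X Y) : Prop :=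
  exists (i : approaching_map (fish_dom p) (fish_dom q))
         (j : approaching_map (fish_cod p) (fish_cod q)),
    [/\ combines idfun i, combines idfun j &
        approaching_homotopic (amap_comp j (fish_map p))
                              (amap_comp (fish_map q) i)].

Definition fish_hom (X Y : metrizable_space) : Type :=
  quotient (@fish_equiv X Y).

Definition fish_class (X Y : metrizable_space) (M : AR_Zembedding X)
    (N : AR_Zembedding Y) (f : approaching_map M N) : fish_hom X Y :=
  class (@fish_equiv X Y) (FishRep f).

Record fine_shape_category := FineShapeCategory {
  fish_cat :> category_on fish_hom;
  fish_id : forall (X : metrizable_space) (M : AR_Zembedding X),
    id1 fish_cat X = fish_class (amap_id M);
  fish_comp : forall (X Y Z : metrizable_space) (M : AR_Zembedding X)
      (N : AR_Zembedding Y) (L : AR_Zembedding Z)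
      (g : approaching_map N L) (f : approaching_map M N),
    comp fish_cat (fish_class g) (fish_class f) = fish_class (amap_comp g f) }.

Definition hilbert_cube : topologicalType :=
  prod_topology (fun _ : nat => set_type unit_itv).

Record Zcompactum := ZCompactum {
  zc_space :> metrizable_space;
  zc_compact : compact [set: zc_space];
  zc_zemb : Zembedding zc_space hilbert_cube }.

Record proper (S T : topologicalType) (D : set S) (B : set T)
    (f : S -> T) : Prop := Proper {
  proper_cts : {within D, continuous f};
  proper_fun : forall x, D x -> ~ B (f x);
  proper_compact : forall K : set T, K `<=` ~` B -> compact K ->
    compact (D `&` f @^-1` K) }.

Definition zc_compl (X : Zcompactum) : set hilbert_cube := ~` range (zc_zemb X).

Record proper_map (X Y : Zcompactum) := ProperMap {
  pmap :> hilbert_cube -> hilbert_cube;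
  pmapP : proper (zc_compl X) (range (zc_zemb Y)) pmap }.

Definition proper_homotopic (X Y : Zcompactum) (f g : proper_map X Y) : Prop :=
  exists h : hilbert_cube * R -> hilbert_cube,
    [/\ proper (zc_compl X `*` unit_itv) (range (zc_zemb Y)) h,
        (forall m, zc_compl X m -> h (m, 0) = f m) &
        (forall m, zc_compl X m -> h (m, 1) = g m)].

Lemma proper_id (X : Zcompactum) :
  proper (zc_compl X) (range (zc_zemb X)) (@idfun hilbert_cube).
Proof.
split=> //; first by apply: continuous_subspaceT => x; exact: cvg_id.
by move=> K KX; rewrite preimage_id setIC (setIidl KX).
Qed.

Lemma proper_comp (X Y Z : Zcompactum) (g : proper_map Y Z)
    (f : proper_map X Y) :
  proper (zc_compl X) (range (zc_zemb Z)) (g \o f).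
Proof.
case: f g => [f [cf Df Kf]] [g [cg Dg Kg]]; split=> /=.
- exact: (within_comp Df cf cg).
- by move=> x /Df/Dg.
- move=> K KZ cK; have := Kf _ (@subIsetl _ _ _) (Kg _ KZ cK).
  congr compact; apply/seteqP; split=> x /=; first by case=> ? [].
  by case=> Xx Kx; split=> //; split=> //; exact: Df.
Qed.

Definition pmap_id (X : Zcompactum) : proper_map X X := ProperMap (proper_id X).

Definition pmap_comp (X Y Z : Zcompactum) (g : proper_map Y Z)
  (f : proper_map X Y) : proper_map X Z := ProperMap (proper_comp g f).

Definition strong_shape_hom (X Y : Zcompactum) : Type :=
  quotient (@proper_homotopic X Y).

Definition strong_shape_class (X Y : Zcompactum) (f : proper_map X Y) :
  strong_shape_hom X Y := class (@proper_homotopic X Y) f.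

Record strong_shape_category := StrongShapeCategory {
  ssh_cat :> category_on strong_shape_hom;
  ssh_id : forall X : Zcompactum,
    id1 ssh_cat X = strong_shape_class (pmap_id X);
  ssh_comp : forall (X Y Z : Zcompactum) (g : proper_map Y Z)
      (f : proper_map X Y),
    comp ssh_cat (strong_shape_class g) (strong_shape_class f) =
    strong_shape_class (pmap_comp g f) }.

End topology.

(* Main.v *)
Require Import Defs.
From HB Require Import structures.
From mathcomp Require Import all_boot all_order all_algebra.
From mathcomp Require Import all_classical all_reals all_analysis.
From mathcomp Require Import ring lra.

(* Idea.  Kuratowski's map embeds a bounded metric space X isometrically in the
   space of functions X -> [0, 1] with the sup distance.  Inside the product of
   this space with [0, 1], take all points of positive height together with the
   image of X at height 0.  There X is closed and is a Z-set (increase the height).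
   This cone is an absolute extensor: Hausdorff's formula extends each coordinate,
   equicontinuously in the coordinate, and off the closed set the height is made
   positive by taking the maximum with the distance to that set.  Hence every AR,
   being a retract of its cone, is an absolute extensor, and maps and homotopies
   given on closed sets can be extended and then pushed off a Z-set.  This gives
   the existence and uniqueness of phi_MN, hence (a).

   (b) Only Y has to be an ANR.  Let l_t deform N so that l_1 retracts a
   neighbourhood of Y onto Y, let h_t push M off X, and choose tau : M -> [0, 1]
   positive on X and so small that Phi (h_s x) lies in that neighbourhood for x in
   X and 0 < s <= tau x.  An approaching map Phi is homotopic to l_1 Phi, which is
   homotopic to l_1 Phi h_tau, always pushing off Y by the distance to X; the last
   map extends continuously to X by phi := l_1 Phi h_tau.  The same formula,
   applied to an approaching homotopy, gives injectivity.

   (c) The Hilbert cube is an AR, and for maps between complements of closed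
   subsets of a compact metrizable space proper is the same as approaching. *)

Set Implicit Arguments.
Unset Strict Implicit.
Unset Printing Implicit Defensive.

Import Order.TTheory GRing.Theory Num.Theory.
Import numFieldNormedType.Exports.

Local Open Scope classical_set_scope.
Local Open Scope ring_scope.

(** * Metrics bounded by 1 *)

Section metrics.
Variable R : realType.

(** The metric is a datum on a given topological space rather than a structure on the type, so it
    can be chosen, replaced or transported freely. The bound by 1 puts the distance functions among
    the maps to [0, 1], where Kuratowski's embedding and the extension formula live. *)
Record metrizes (T : topologicalType) (d : T -> T -> R) : Prop := Metrizes {
  mz_refl : forall x, d x x = 0;
  mz_eq : forall x y, d x y = 0 -> x = y;
  mz_sym : forall x y, d x y = d y x;
  mz_triangle : forall y x z, d x z <= d x y + d y z;
  mz_le1 : forall x y, d x y <= 1;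
  mz_nbhs : forall x (U : set T),
    nbhs x U <-> exists2 e, 0 < e & forall y, d x y < e -> U y }.

Lemma mz_ge0 (T : topologicalType) (d : T -> T -> R) : metrizes d ->
  forall x y, 0 <= d x y.
Proof.
move=> md x y; have := mz_triangle md y x x; rewrite (mz_refl md) (mz_sym md y).
lra.
Qed.

Lemma min1_triangle (a b c : R) : 0 <= b -> 0 <= c -> a <= b + c ->
  Num.min a 1 <= Num.min b 1 + Num.min c 1.
Proof.
move=> b0 c0 abc; rewrite /Num.min.
by case: ifPn => ?; case: ifPn => ?; case: ifPn => ?; lra.
Qed.

Lemma metrizes_min1 (T : topologicalType) (D : metricType R) (f : T -> D)
  (g : D -> T) : continuous f -> continuous g -> cancel f g ->
  metrizes (fun x y => Num.min (mdist (f x) (f y)) 1).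
Proof.
move=> cf cg fK; split.
- by move=> x; rewrite mdistxx min_l.
- move=> x y; rewrite /Num.min; case: ifPn => [_ /mdist_positivity/(congr1 g)|_].
    by rewrite !fK.
  by move/eqP; rewrite oner_eq0.
- by move=> x y; rewrite metric_sym.
- move=> y x z; apply: min1_triangle; rewrite ?mdist_ge0//.
  exact: metric_triangle.
- by move=> x y; rewrite ge_min lexx orbT.
- move=> x U; split=> [xU|[e e0 eU]].
    have : nbhs (f x) (g @^-1` U) by apply: cg; rewrite fK.
    rewrite -metricType_numDomainType.filter_from_mdist_nbhs => -[e /= e0 eU].
    exists (Num.min e 1); first by rewrite lt_min e0 ltr01.
    move=> y; rewrite -[y]fK => ye; apply: eU; move: ye; rewrite fK.
    by rewrite lt_min !gt_min ltxx orbF => /andP[/orP[//|/ltW]]; lra.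
  have /cf h : nbhs (f x) [set z | mdist (f x) z < Num.min e 1].
    rewrite -metricType_numDomainType.filter_from_mdist_nbhs.
    by exists (Num.min e 1) => //=; rewrite lt_min e0 ltr01.
  apply: (filterS _ (h : nbhs x _)) => y /= {}h; apply: eU.
  by rewrite gt_min (lt_le_trans h)// ge_min lexx.
Qed.

Lemma metrizable_metrizes (T : topologicalType) :
  metrizable R T -> exists d, @metrizes T d.
Proof. by case=> D [f [g [cf cg fK _]]]; eexists; exact: (metrizes_min1 cf cg fK). Qed.

(** A copy of [T] indexed by the proof [md], so that the metric structure attached to it is
    determined by [d]. *)
Definition metric_copy (T : topologicalType) (d : T -> T -> R)
  (md : metrizes d) : Type := T.

Section metric_copy.
Variables (T : topologicalType) (d : T -> T -> R) (md : metrizes d).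

HB.instance Definition _ := Choice.on (metric_copy md).
HB.instance Definition _ := @isMetric.Build R (metric_copy md) d
  (mz_refl md) (mz_eq md) (mz_sym md) (mz_triangle md).

Lemma metrizes_metrizable : metrizable R T.
Proof.
exists (metric_copy md); exists (fun x => x), (fun x => x); split=> //.
- move=> x U xU; have : @nbhs _ (metric_copy md) x U := xU.
  rewrite -metricType_numDomainType.filter_from_mdist_nbhs => -[e e0 eU].
  by apply/(mz_nbhs md); exists e.
- move=> x U /(mz_nbhs md)[e e0 eU]; change (@nbhs _ (metric_copy md) x U).
  by rewrite -metricType_numDomainType.filter_from_mdist_nbhs; exists e.
Qed.
End metric_copy.

Lemma mz_cvg (T : topologicalType) (d : T -> T -> R) (u : nat -> T) (x : T) :
  metrizes d -> u @ \oo --> x <->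
  forall e, 0 < e -> exists N, forall n, (N <= n)%N -> d x (u n) < e.
Proof.
move=> md; split=> [ux e e0|ux U].
  have /ux[N _ NU] : nbhs x [set y | d x y < e].
    by apply/(mz_nbhs md); exists e.
  by exists N => n /NU.
move=> /(mz_nbhs md)[e e0 eU]; have [N NU] := ux e e0.
by exists N => // n /= /NU/eU.
Qed.

Lemma mz_cts (T T' : topologicalType) (d : T -> T -> R) (d' : T' -> T' -> R)
    (f : T -> T') : metrizes d -> metrizes d' ->
  (forall x e, 0 < e -> exists2 r, 0 < r &
     forall y, d x y < r -> d' (f x) (f y) < e) ->
  continuous f.
Proof.
move=> md md' H x U /(mz_nbhs md')[e e0 eU]; have [r r0 rU] := H x e e0.
by apply/(mz_nbhs md); exists r => // y /rU/eU.
Qed.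

Lemma mz_hausdorff (T : topologicalType) (d : T -> T -> R) :
  metrizes d -> hausdorff_space T.
Proof.
move=> md x y xy; apply: (mz_eq md); apply: le_anti.
rewrite (mz_ge0 md) andbT leNgt; apply/negP => d0.
have nx z : nbhs z [set w | d z w < d x y / 2].
  by apply/(mz_nbhs md); exists (d x y / 2) => //; lra.
have [w /= [xw yw]] := xy _ _ (nx x) (nx y).
by have := mz_triangle md w x y; rewrite (mz_sym md w); lra.
Qed.

Lemma metrizes_R : metrizes (fun x y : R => Num.min `|x - y| 1).
Proof.
have := @metrizes_min1 R R^o idfun idfun.
rewrite /mdist/=; under eq_fun do under eq_fun do rewrite distrC.
apply=> //; by move=> x; exact: cvg_id.
Qed.

Lemma metrizes_prod (T T' : topologicalType) (d : T -> T -> R)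
    (d' : T' -> T' -> R) : metrizes d -> metrizes d' ->
  metrizes (fun p q : T * T' => Num.max (d p.1 q.1) (d' p.2 q.2)).
Proof.
move=> md md'; split.
- by move=> x; rewrite (mz_refl md) (mz_refl md') maxxx.
- move=> [x x'] [y y'] /= h.
  have [h1 h2] : d x y <= 0 /\ d' x' y' <= 0.
    by rewrite -h !le_max !lexx orbT.
  congr pair; [apply: (mz_eq md)|apply: (mz_eq md')]; apply: le_anti.
    by rewrite h1 (mz_ge0 md).
  by rewrite h2 (mz_ge0 md').
- by move=> x y; rewrite (mz_sym md) (mz_sym md').
- move=> y x z; rewrite ge_max; apply/andP; split.
    by apply: (le_trans (mz_triangle md y.1 _ _)); rewrite lerD// le_max lexx.
  apply: (le_trans (mz_triangle md' y.2 _ _)).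
  by rewrite lerD// le_max lexx orbT.
- by move=> x y; rewrite ge_max (mz_le1 md) (mz_le1 md').
- move=> [x x'] U; split.
    move=> [[V V'] /= [/(mz_nbhs md)[e e0 eV] /(mz_nbhs md')[e' e0' eV']] VU].
    exists (Num.min e e'); first by rewrite lt_min e0.
    move=> [y y'] /=; rewrite gt_max !lt_min => /andP[/andP[? _] /andP[_ ?]].
    by apply: VU; split=> /=; [exact: eV|exact: eV'].
  move=> [e e0 eU]; exists ([set y | d x y < e], [set y | d' x' y < e]) => /=.
    by split; [apply/(mz_nbhs md)|apply/(mz_nbhs md')]; exists e.
  by move=> [y y'] /= [h h']; apply: eU; rewrite gt_max h.
Qed.

Lemma metrizable_R : metrizable R R.
Proof. exact: metrizes_metrizable metrizes_R. Qed.

Lemma metrizable_prod (S T : topologicalType) :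
  metrizable R S -> metrizable R T -> metrizable R (S * T)%type.
Proof.
move=> /metrizable_metrizes[d md] /metrizable_metrizes[d' md'].
exact: metrizes_metrizable (metrizes_prod md md').
Qed.

Lemma distance_to (T : topologicalType) (d : T -> T -> R) (C : set T) :
  metrizes d -> closed C -> exists D : T -> R,
  [/\ forall x, 0 <= D x <= 1, forall x, D x = 0 <-> C x,
      forall x y, D x <= d x y + D y,
      forall x c, C c -> D x <= d x c &
      C !=set0 -> forall x e, D x < e -> exists2 c, C c & d x c < e].
Proof.
move=> md cC; have [C0|C0] := pselect (C !=set0); last first.
  (* For empty [C] the infimum makes no sense; the constant 1 still has zero set [C]. *)
  exists (fun=> 1); split=> //.
  - by move=> x; rewrite ler01 lexx.
  - move=> x; split=> [/eqP|Cx]; first by rewrite oner_eq0.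
    by case: C0; exists x.
  - by move=> x y; rewrite lerDr (mz_ge0 md).
  - by move=> x c Cc; case: C0; exists c.
have hi x : has_inf [set d x c | c in C].
  split; first by case: C0 => c Cc; exists (d x c), c.
  by exists 0 => _ [c _ <-]; exact: (mz_ge0 md).
have Dle x c : C c -> inf [set d x c | c in C] <= d x c.
  by move=> Cc; apply: (ge_inf (hi x).2); exists c.
have Dge x : 0 <= inf [set d x c | c in C].
  by apply: (lb_le_inf (hi x).1) => _ [c _ <-]; exact: (mz_ge0 md).
have Dlt x e : inf [set d x c | c in C] < e -> exists2 c, C c & d x c < e.
  by move=> /(inf_lt (hi x).1)[_ [c Cc <-] ?]; exists c.
exists (fun x => inf [set d x c | c in C]); split=> //.
- move=> x; rewrite Dge/=; have [c Cc] := C0.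
  exact: (le_trans (Dle x c Cc) (mz_le1 md _ _)).
- move=> x; split=> [Dx|Cx].
    apply: cC => U /(mz_nbhs md)[e e0 eU].
    have [|c Cc /eU Uc] := Dlt x e; first by rewrite Dx.
    by exists c.
  by apply: le_anti; rewrite Dge andbT (le_trans (Dle x x Cx))// (mz_refl md).
- move=> x y; rewrite -lerBlDl; apply: (lb_le_inf (hi y).1) => _ [c Cc <-].
  rewrite lerBlDl; apply: (le_trans (Dle _ _ Cc)); exact: mz_triangle.
Qed.

End metrics.

(** * Extension of families of functions; function spaces with the sup distance *)

Section extension.
Variable R : realType.

(* Hausdorff's formula [F z = inf_a (u a + d(z, a) / d(z, A)) - 1] extends [u] off
   A with a modulus of continuity independent of the member of the family. *)
Lemma equicontinuous_extension (Z : topologicalType) (d : Z -> Z -> R)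
    (A : set Z) (I : Type) (u : I -> Z -> R) :
  metrizes d -> closed A -> A !=set0 ->
  (forall i a, A a -> 0 <= u i a <= 1) ->
  (forall a e, A a -> 0 < e -> exists2 r, 0 < r &
    forall b, A b -> d a b < r -> forall i, `|u i a - u i b| <= e) ->
  exists F : I -> Z -> R,
  [/\ forall i z, 0 <= F i z <= 1, forall i a, A a -> F i a = u i a &
      forall z e, 0 < e -> exists2 r, 0 < r &
        forall w, d z w < r -> forall i, `|F i z - F i w| <= e].
Proof.
move=> md cA A0 u01 ucts; have d0 := mz_ge0 md.
have [D [D01 D0 Dtri Dle /(_ A0) Dlt]] := distance_to md cA.
have Dgt z : ~ A z -> 0 < D z.
  move=> nAz; rewrite lt_neqAle (andP (D01 z)).1 andbT eq_sym.
  by apply/eqP => /D0.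
(* Hausdorff's infimum multiplied by [D z], which clears the denominator: off [A] it equals
   [D z * (1 + F i z)]. *)
pose S i z := [set D z * u i a + d z a | a in A].
have hS i z : has_inf (S i z).
  split; first by case: A0 => c Ac; exists (D z * u i c + d z c), c.
  exists 0 => _ [c Ac <-]; rewrite addr_ge0 ?mulr_ge0//.
    by case/andP: (D01 z).
  by case/andP: (u01 i c Ac).
pose G i z := inf (S i z).
have Gle i z a : A a -> G i z <= D z * u i a + d z a.
  by move=> Aa; apply: (ge_inf (hS i z).2); exists a.
have Gge i z c : (forall a, A a -> c <= D z * u i a + d z a) -> c <= G i z.
  by move=> h; apply: (lb_le_inf (hS i z).1) => _ [a Aa <-]; exact: h.
pose F i z := if pselect (A z) then u i z else G i z / D z - 1.
have FA i a : A a -> F i a = u i a by rewrite /F; case: pselect.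
have FnA i z : ~ A z -> G i z = D z * (1 + F i z).
  move=> nAz; rewrite /F; case: (pselect (A z)) => [//|? /=].
  by have ? := Dgt z nAz; field; rewrite gt_eqF.
have Flow i z c : ~ A z ->
    (forall a, A a -> D z * c <= D z * u i a + d z a - D z) -> c <= F i z.
  move=> nAz h; rewrite -(ler_pM2l (Dgt z nAz)).
  have : D z * c + D z <= G i z by apply: Gge => a /h; lra.
  rewrite FnA//; lra.
have Fup i z a : ~ A z -> A a -> D z * F i z <= D z * u i a + d z a - D z.
  by move=> nAz /(Gle i z); rewrite FnA//; lra.
have F01 i z : 0 <= F i z <= 1.
  have [Az|nAz] := pselect (A z); first by rewrite FA//; exact: u01.
  have Dz := Dgt z nAz; apply/andP; split.
    apply: Flow => // a Aa; rewrite mulr0.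
    have := Dle z a Aa; have /andP[+ _] := u01 i a Aa.
    by move=> /(mulr_ge0 (ltW Dz)); lra.
  apply/ler_addgt0Pr => e e0.
  have [|a Aa dza] := Dlt z (D z * (1 + e)).
    by rewrite ltr_pMr// ltrDl.
  rewrite -(ler_pM2l Dz); apply: (le_trans (Fup i z a nAz Aa)).
  have /andP[_] := u01 i a Aa; rewrite -(ler_pM2l Dz).
  by move: dza; rewrite !mulrDr; lra.
exists F; split=> // z e e0.
have [Az|nAz] := pselect (A z).
  have [r r0 ur] := ucts z (e / 2) Az (divr_gt0 e0 (ltr0Sn _ 1)).
  (* Then [D w < r / 3] too, and a point of [A] within [2 * D w] of [w] is within [r] of [z], where
     [u] is controlled. *)
  exists (r / 3) => [|w zw i]; first lra.
  have [Aw|nAw] := pselect (A w).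
    rewrite !FA//; apply: (@le_trans _ _ (e / 2)); last lra.
    by apply: ur => //; lra.
  have Dw := Dgt w nAw.
  have Dwr : D w < r / 3.
    by rewrite (le_lt_trans (Dle w z Az))// (mz_sym md).
  rewrite (FA _ z)//; have uz01 := u01 i z Az.
  rewrite ler_norml; apply/andP; split.
    (* [h] bounds the error of a nearly nearest point [a]; the cap 1 keeps [a] within [2 * D w] of
       [w]. *)
    pose h := Num.min (e / 2) 1.
    have h0 : 0 < h by rewrite lt_min; apply/andP; split; lra.
    have [|a Aa dwa] := Dlt w (D w * (1 + h)); first by rewrite ltr_pMr// ltrDl.
    have h1 : h <= 1 by rewrite ge_min lexx orbT.
    have he : h <= e / 2 by rewrite ge_min lexx.
    have dza : d z a < r.
      apply: (le_lt_trans (mz_triangle md w z a)).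
      have : D w * (1 + h) <= D w * 2 by rewrite ler_pM2l//; lra.
      by lra.
    have /(_ i) := ur a Aa dza; rewrite ler_norml => /andP[ua _].
    suff : F i w <= u i a + h by lra.
    rewrite -(ler_pM2l Dw); apply: (le_trans (Fup i w a nAw Aa)).
    by move: dwa; rewrite !mulrDr; lra.
  suff : u i z - e <= F i w by lra.
  apply: Flow => // a Aa; have /andP[ua0 ua1] := u01 i a Aa.
  have [dza|dza] := ltP (d z a) r.
    have /(_ i) := ur a Aa dza; rewrite ler_norml => /andP[_ uza].
    have : D w * (u i z - e) <= D w * u i a by rewrite ler_pM2l//; lra.
    by have := Dle w a Aa; lra.
  (* A point [a] at distance at least [r] from [z] has [d w a > 2 * D w], so its term in the infimum
     is above 1, hence above [u i z]. *)
  have : D w * (u i z - e) <= D w * 1 by rewrite ler_pM2l//; lra.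
  have := mulr_ge0 (ltW Dw) ua0.
  by have := mz_triangle md w z a; lra.
have Dz := Dgt z nAz.
(* The first bound keeps [w] off [A]. The second comes from [D z * (F z - F w) = (G z - G w) - (D z
   - D w) * (1 + F w)], where [G] is 2-Lipschitz, [D] is 1-Lipschitz and [1 + F w <= 2]: in all
   [4 * d z w]. *)
exists (Num.min (D z / 2) (e * D z / 4)).
  by rewrite lt_min; apply/andP; split; rewrite divr_gt0// mulr_gt0.
move=> w; rewrite lt_min => /andP[zw1 zw2] i.
have nAw : ~ A w by move=> /D0 Dw; have := Dtri z w; lra.
have Dw := Dgt w nAw.
have Glip x y : G i x <= G i y + 2 * d x y.
  rewrite -lerBlDr; apply: Gge => a Aa.
  have := Gle i x a Aa; have := mz_triangle md y x a.
  have /andP[ua0 ua1] := u01 i a Aa; have := ler_wpM2r ua0 (Dtri x y).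
  have := ler_wpM2l (d0 x y) ua1; lra.
have := Glip z w; have := Glip w z; rewrite !FnA// (mz_sym md w).
have := Dtri z w; have := Dtri w z; rewrite (mz_sym md w) => D1 D2.
have /andP[Fz0 Fz1] := F01 i z; have /andP[Fw0 Fw1] := F01 i w.
have Fw2 : 0 <= 1 + F i w <= 2 by lra.
move=> G1 G2; rewrite ler_norml.
have m1 := ler_wpM2r (andP Fw2).1 D1; have m2 := ler_wpM2r (andP Fw2).1 D2.
have m3 := ler_wpM2l (d0 z w) (andP Fw2).2.
by apply/andP; split; rewrite -(ler_pM2l Dz); lra.
Qed.

(** Absolute extensors. Since [f] is a total function, the empty space satisfies this vacuously;
    therefore [AE_AR] takes a point of [M] as an argument. *)
Definition AE (N : topologicalType) : Prop :=
  forall (Z : metrizable_space R) (A : set Z) (f : Z -> N),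
    closed A -> {within A, continuous f} ->
    exists2 F : Z -> N, continuous F & forall z, A z -> F z = f z.

(** One construction for two uses: [P] cuts the cone out of a function space, and the trivial [P]
    gives a space containing the Hilbert cube. The point [i0] is a parameter of the type because the
    supremum defining the distance must be over a nonempty set. *)
Record sup_space (I : Type) (i0 : I) (P : (I -> R) -> Prop) := SupSpace {
  sup_fun :> I -> R;
  sup_fun01 : forall i, 0 <= sup_fun i <= 1;
  sup_funP : P sup_fun }.

Section sup_space.
Variables (I : Type) (i0 : I) (P : (I -> R) -> Prop).
Local Notation S := (sup_space i0 P).

Lemma sup_space_eq (f g : S) : f =1 g :> (I -> R) -> f = g.
Proof.
case: f g => [f f01 Pf] [g g01 Pg] /= fg.
have {}fg : f = g by exact/funext.
by subst g; congr SupSpace; exact: Prop_irrelevance.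
Qed.

HB.instance Definition _ := gen_eqMixin S.
HB.instance Definition _ := gen_choiceMixin S.

Definition sup_dist (f g : S) : R := sup (range (fun i => `|f i - g i|)).

Lemma sup_dist_ub (f g : S) i : `|f i - g i| <= sup_dist f g.
Proof.
apply: ub_le_sup; last by exists i.
exists 1 => _ [j _ <-].
by have := sup_fun01 f j; have := sup_fun01 g j; rewrite ler_norml; lra.
Qed.

Lemma sup_dist_le (f g : S) c :
  (forall i, `|f i - g i| <= c) -> sup_dist f g <= c.
Proof. by move=> h; apply: ge_sup => [|_ [i _ <-]//]; exists `|f i0 - g i0|, i0. Qed.

Lemma sup_dist_refl f : sup_dist f f = 0.
Proof.
apply: le_anti; apply/andP; split.
  by apply: sup_dist_le => i; rewrite subrr normr0.
by rewrite (le_trans _ (sup_dist_ub f f i0)).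
Qed.

Lemma sup_dist_eq f g : sup_dist f g = 0 -> f = g.
Proof.
move=> fg; apply: sup_space_eq => i; apply/eqP.
by rewrite -subr_eq0 -normr_le0 -fg sup_dist_ub.
Qed.

Lemma sup_dist_sym f g : sup_dist f g = sup_dist g f.
Proof. by rewrite /sup_dist; under eq_fun do rewrite distrC. Qed.

Lemma sup_dist_triangle g f h : sup_dist f h <= sup_dist f g + sup_dist g h.
Proof.
apply: sup_dist_le => i; rewrite (le_trans (ler_distD (g i) _ _))//.
by rewrite lerD// sup_dist_ub.
Qed.

HB.instance Definition _ := @isMetric.Build R S sup_dist
  sup_dist_refl sup_dist_eq sup_dist_sym sup_dist_triangle.

Lemma metrizes_sup_dist : metrizes (sup_dist : S -> S -> R).
Proof.
split.
- exact: sup_dist_refl.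
- exact: sup_dist_eq.
- exact: sup_dist_sym.
- exact: sup_dist_triangle.
- move=> f g; apply: sup_dist_le => i.
  by have := sup_fun01 f i; have := sup_fun01 g i; rewrite ler_norml; lra.
- move=> f U; rewrite -metricType_numDomainType.filter_from_mdist_nbhs.
  by split=> -[e e0 eU]; exists e.
Qed.

Lemma sup_space_metrizable : metrizable R S.
Proof. exact: metrizes_metrizable metrizes_sup_dist. Qed.

End sup_space.

End extension.

(** * The cone of a metric space; absolute retracts and extensors *)

Section embeddings.
Variable R : realType.

Lemma embeddingP (S T : topologicalType) (e : S -> T) :
  injective e -> continuous e ->
  (forall x U, nbhs x U -> exists2 V, nbhs (e x) V & e @^-1` V `<=` U) ->
  embedding e.
Proof.
move=> ie ce eU; split=> // U; split=> [oU|[V oV <-]]; last first.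
  by apply: open_comp => // x _; exact: ce.
exists (\bigcup_(V in [set V | open V /\ e @^-1` V `<=` U]) V).
  by apply: bigcup_open => V [].
apply/seteqP; split=> [x [V [_ VU] Vx]|x Ux]; first exact: VU.
have [V] := eU x U (open_nbhs_nbhs (conj oU Ux)).
rewrite nbhsE => -[W [oW Wx] WV] VU; exists W => //; split=> // y Wy.
by apply: VU; exact: WV.
Qed.

Lemma embedding_continuous (S T : topologicalType) (e : S -> T) :
  embedding e -> continuous e.
Proof. by move=> [_ oe]; apply/continuousP => V oV; apply/oe; exists V. Qed.

Lemma embedding_nbhs (S T : topologicalType) (e : S -> T) x U :
  embedding e -> nbhs x U -> exists2 V, nbhs (e x) V & e @^-1` V `<=` U.
Proof.
move=> [_ oe]; rewrite nbhsE => -[W [/oe[V oV VW] Wx] WU]; exists V.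
  by apply: open_nbhs_nbhs; split=> //; rewrite -VW in Wx.
by rewrite VW.
Qed.

Lemma isometry_embedding (S T : topologicalType) (d : S -> S -> R)
    (d' : T -> T -> R) (e : S -> T) : metrizes d -> metrizes d' ->
  (forall x y, d' (e x) (e y) = d x y) -> embedding e.
Proof.
move=> md md' de; apply: embeddingP.
- by move=> x y exy; apply: (mz_eq md); rewrite -de exy (mz_refl md').
- by apply: (mz_cts md md') => x r r0; exists r => // y; rewrite de.
- move=> x U /(mz_nbhs md)[r r0 rU]; exists [set z | d' (e x) z < r].
    by apply/(mz_nbhs md'); exists r.
  by move=> y /=; rewrite de => /rU.
Qed.

Lemma within_range (S T U : topologicalType) (e : S -> T) (g : T -> U) :
  embedding e -> continuous (g \o e) -> {within range e, continuous g}.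
Proof.
move=> ee cge; apply/subspace_continuousP => _ [x _ <-] U' gU.
have [V Vx VU] := embedding_nbhs ee (cge x U' gU).
change (nbhs (e x) [set y | range e y -> U' (g y)]).
by apply: (filterS _ Vx) => y Vy [z _ zy]; rewrite -zy; apply: VU; rewrite /= zy.
Qed.

(** Turns a map on [S] into a map on the subset [range e], the form of data that [AE] extends; [u0]
    is a dummy value off this subset. *)
Lemma extend_from_range (S T U : topologicalType) (e : S -> T) (f : S -> U)
    (u0 : U) : embedding e -> continuous f ->
  exists2 g : T -> U, {within range e, continuous g} & forall x, g (e x) = f x.
Proof.
move=> ee cf.
pose g y := if pselect (exists x, e x = y) is left h then f (projT1 (cid h))
            else u0.
have ge x : g (e x) = f x.
  rewrite /g; case: pselect => [h|[]]; last by exists x.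
  by case: cid => x' /= /ee.1 ->.
exists g => //; apply: within_range => //.
by rewrite (_ : g \o e = f)//; exact/funext.
Qed.

(** The inverse of [e], extended over [Z] and followed by [e], is the retraction. *)
Lemma AE_AR (M : metrizable_space R) (m0 : M) : AE R M -> is_AR M.
Proof.
move=> aeM Z e ee ce.
have [|g cg ge] := extend_from_range m0 ee (f := id); first by move=> x; exact: cvg_id.
have [F cF Fg] := aeM Z _ _ ce cg.
exists (e \o F); split.
- by move=> z; apply: continuous_comp; [exact: cF|exact: embedding_continuous].
- by move=> z; exists (F z).
- by move=> m /=; rewrite Fg ?ge//; exists m.
Qed.

Lemma lipschitz_continuous (T : topologicalType) (d : T -> T -> R) (D : T -> R) :
  metrizes d -> (forall x y, D x <= d x y + D y) -> continuous D.
Proof.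
move=> md Dd; apply: (mz_cts md (metrizes_R R)) => x e e0; exists e => // y xy.
rewrite gt_min ltr_norml; apply/orP; left; have := Dd x y.
by have := Dd y x; rewrite (mz_sym md y); lra.
Qed.

(** Continuity in the sup distance is equicontinuity of the coordinates, which is what Hausdorff's
    formula consumes and preserves. *)
Lemma sup_space_extension (I : Type) (i0 : I) (P : (I -> R) -> Prop)
    (Z : topologicalType) (d : Z -> Z -> R) (A : set Z) (f : Z -> sup_space i0 P) :
  metrizes d -> closed A -> A !=set0 -> {within A, continuous f} ->
  exists F : I -> Z -> R,
  [/\ forall i z, 0 <= F i z <= 1, forall i a, A a -> F i a = f a i &
      forall z e, 0 < e -> exists2 r, 0 < r &
        forall w, d z w < r -> forall i, `|F i z - F i w| <= e].
Proof.
move=> mZ cA A0 cf.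
apply: (equicontinuous_extension (u := fun i z => f z i) mZ cA A0) => [i a _|a e Aa e0].
  exact: sup_fun01.
have fa : nbhs (f a) [set g | sup_dist (f a) g < e].
  by apply/(mz_nbhs (metrizes_sup_dist i0 P)); exists e.
move/subspace_continuousP : cf => /(_ a Aa _ fa)/(mz_nbhs mZ)[r r0 rf].
exists r => // b Ab ab i.
exact: le_trans (sup_dist_ub _ _ i) (ltW (rf b ab Ab)).
Qed.

(** * The cone over Kuratowski's embedding *)

Section cone.
Variables (X : topologicalType) (d : X -> X -> R) (md : metrizes d).

(** The index [Some y] is a coordinate of Kuratowski's embedding and [None] is the height, so that
    the product of the function space with [0, 1] is again a function space with the sup
    distance. *)
Definition cone_base (x : X) (o : option X) : R :=
  if o is Some y then d x y else 0.

Definition cone_pred (g : option X -> R) : Prop :=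
  0 < g None \/ exists x, g = cone_base x.

Definition cone := sup_space None cone_pred.

HB.instance Definition _ := Metric.on cone.

Definition cone_space : metrizable_space R :=
  @MetrizableSpace R cone (sup_space_metrizable None cone_pred).

Lemma metrizes_cone : metrizes (@sup_dist R _ None cone_pred : cone -> cone -> R).
Proof. exact: metrizes_sup_dist. Qed.

Lemma cone_base01 x o : 0 <= cone_base x o <= 1.
Proof.
by case: o => [y|] /=; rewrite ?lexx ?ler01// (mz_ge0 md) (mz_le1 md).
Qed.

Definition cone_emb (x : X) : cone :=
  SupSpace None (cone_base01 x) (or_intror (ex_intro _ x erefl)).

Definition cone_top : cone.
Proof.
apply: (@SupSpace R _ None cone_pred (fun=> 1)); first by move=> _; rewrite ler01 lexx.
by left; rewrite ltr01.
Defined.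

(** The triangle inequality bounds every coordinate, and the coordinate [Some y] attains the
    bound. *)
Lemma cone_emb_isometry x y : sup_dist (cone_emb x) (cone_emb y) = d x y.
Proof.
apply: le_anti; apply/andP; split.
  apply: sup_dist_le => -[z|] /=; last by rewrite subrr normr0 (mz_ge0 md).
  have := mz_triangle md y x z; have := mz_triangle md x y z.
  by rewrite (mz_sym md y x) ler_norml; lra.
apply: (le_trans _ (sup_dist_ub (cone_emb x) (cone_emb y) (Some y))) => /=.
by rewrite (mz_refl md) subr0 ler_norm.
Qed.

Lemma embedding_cone : embedding cone_emb.
Proof. exact: (isometry_embedding md metrizes_cone cone_emb_isometry). Qed.

Lemma range_cone : range cone_emb = [set g : cone | g None = 0].
Proof.
apply/seteqP; split=> [_ [x _ <-]//|g /= g0].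
case: (sup_funP g) => [|[x gx]]; first by rewrite g0 ltxx.
by exists x => //; apply: sup_space_eq => o; rewrite gx.
Qed.

Lemma sup_fun_continuous i : continuous (fun g : cone => g i).
Proof.
apply: (lipschitz_continuous metrizes_cone) => g h.
have := ler_norm (g i - h i); have := sup_dist_ub g h i; lra.
Qed.

(** The nearest-point retraction of the line onto [0, 1]; it lets homotopies take all real times. *)
Definition clamp (t : R) : R := Num.max 0 (Num.min t 1).

Lemma clamp01 t : 0 <= clamp t <= 1.
Proof. by rewrite le_max lexx /= ge_max ler01 ge_min lexx orbT. Qed.

Lemma clamp_id t : 0 <= t <= 1 -> clamp t = t.
Proof. by move=> /andP[t0 t1]; rewrite /clamp min_l// max_r. Qed.

Lemma clamp_gt0 t : 0 < t -> 0 < clamp t.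
Proof. by move=> t0; rewrite lt_max lt_min t0 ltr01 orbT. Qed.

Lemma max_lip (a b c e r : R) : `|a - c| <= r -> `|b - e| <= r ->
  `|Num.max a b - Num.max c e| <= r.
Proof.
by rewrite !ler_norml /Num.max; case: ifPn => ?; case: ifPn => ?; lra.
Qed.

Lemma clamp_lip s t : `|clamp s - clamp t| <= Num.min `|s - t| 1.
Proof.
rewrite /clamp; have [st|st] := leP `|s - t| 1.
  apply: max_lip; first by rewrite subrr normr0.
  by move: st; rewrite /Num.min !ler_norml -/(`|s - t|);
   case: ifPn => ?; case: ifPn => ?; have := ler_norm (s - t);
   have := ler_norm (t - s); rewrite (distrC t); lra.
by have := clamp01 s; have := clamp01 t; rewrite /clamp ler_norml; lra.
Qed.

(** Only the height moves. A maximum, unlike a sum, stays in [0, 1] and gives the identity at time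
    0. *)
Definition cone_push_fun (g : cone) (t : R) (o : option X) : R :=
  if o is Some y then g o else Num.max (g None) (clamp t).

Lemma cone_push_fun01 g t o : 0 <= cone_push_fun g t o <= 1.
Proof.
case: o => [y|]; first exact: sup_fun01.
have := sup_fun01 g None; have := clamp01 t => /andP[? ?] /andP[? ?] /=.
by rewrite le_max ge_max; apply/andP; split; apply/orP || apply/andP; first left.
Qed.

Lemma cone_push_pred g t : cone_pred (cone_push_fun g t).
Proof.
have [t0|t0] := ltP 0 t.
  by left; rewrite /= lt_max clamp_gt0 ?orbT.
have -> : cone_push_fun g t = g.
  apply/funext => -[//|] /=; rewrite max_l//.
  have /andP[g0 _] := sup_fun01 g None.
  by rewrite /clamp ge_max g0 ge_min (le_trans t0 g0).
exact: sup_funP.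
Qed.

Definition cone_push (p : cone * R) : cone :=
  SupSpace None (cone_push_fun01 p.1 p.2) (cone_push_pred p.1 p.2).

Lemma cone_push_continuous : continuous cone_push.
Proof.
apply: (mz_cts (metrizes_prod metrizes_cone (metrizes_R R)) metrizes_cone).
move=> [g s] e e0; exists (e / 2) => [|[h t] /= gh]; first lra.
apply: (@le_lt_trans _ _ (e / 2)); last lra.
move: gh; rewrite gt_max => /andP[/ltW gh /ltW st].
have gho o := le_trans (sup_dist_ub g h o) gh.
apply: sup_dist_le => -[y|] /=; first exact: gho.
by apply: max_lip => //; exact: le_trans (clamp_lip _ _) st.
Qed.

Lemma Zset_cone : is_Zset R (range cone_emb).
Proof.
split.
  rewrite range_cone; apply: (@closed_comp _ _ (fun g : cone => g None) [set 0]).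
    by move=> g _; exact: sup_fun_continuous.
  exact: accessible_closed_set1 (hausdorff_accessible (@norm_hausdorff _ R)) _.
exists cone_push; split.
- by apply: continuous_subspaceT; exact: cone_push_continuous.
- move=> g; apply: sup_space_eq => -[//|] /=.
  rewrite clamp_id ?lexx ?ler01// max_l//.
  by case/andP: (sup_fun01 g None).
- move=> g t /andP[t0 _]; rewrite range_cone /= => h.
  have : 0 < Num.max (g None) (clamp t) by rewrite lt_max clamp_gt0 ?orbT.
  by rewrite h ltxx.
Qed.

Lemma AE_cone : AE R cone.
Proof.
move=> Z A f cA cf; have [dZ mZ] := metrizable_metrizes (metrizableP Z).
have [A0|nA0] := pselect (A !=set0); last first.
  exists (fun=> cone_top); first by move=> z; exact: cvg_cst.
  by move=> z Az; case: nA0; exists z.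
have [F [F01 FA Fcts]] := sup_space_extension mZ cA A0 cf.
have [D [D01 D0 Dtri _ _]] := distance_to mZ cA.
(* [D z] vanishes on [A], so the values of [f] survive, and it is positive elsewhere, which gives
   [cone_pred]. *)
pose G z o := if o is Some y then F o z else Num.max (F None z) (D z).
have G01 z o : 0 <= G z o <= 1.
  case: o => [y|]; first exact: F01.
  by rewrite /G/= le_max ge_max (andP (F01 None z)).1 (andP (F01 None z)).2
    (andP (D01 z)).2.
have GA z : A z -> G z = f z.
  move=> Az; apply/funext => -[y|] /=; rewrite FA// (D0 z).2// max_l//.
  by case/andP: (sup_fun01 (f z) None).
have GP z : cone_pred (G z).
  have [Az|nAz] := pselect (A z); first by rewrite GA//; exact: sup_funP.
  left; rewrite /= lt_max; apply/orP; right.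
  by rewrite lt_neqAle (andP (D01 z)).1 andbT eq_sym; apply/eqP => /D0.
exists (fun z => SupSpace None (G01 z) (GP z)) => [|z Az]; last first.
  by apply: sup_space_eq => o /=; rewrite GA.
apply: (mz_cts mZ metrizes_cone) => z e e0.
have e2 : 0 < e / 2 by lra.
have [r r0 rF] := Fcts z _ e2.
exists (Num.min r (e / 2)) => [|w]; first by rewrite lt_min r0.
rewrite lt_min => /andP[zr ze]; apply: (@le_lt_trans _ _ (e / 2)); last lra.
apply: sup_dist_le => -[y|] /=; first exact: rF.
apply: max_lip; first exact: rF.
have := Dtri z w; have := Dtri w z; rewrite (mz_sym mZ w) ler_norml; lra.
Qed.

End cone.

Definition cone_AR (X : topologicalType) (d : X -> X -> R) (md : metrizes d) :
  AR_Zembedding R X :=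
  @ARZEmbedding R X (cone_space d) (@AE_AR (cone_space d) (cone_top d) (@AE_cone _ d))
    (ZEmbedding (embedding_cone md) (Zset_cone md)).

(** The cone has a point, [cone_top], even over the empty space, and the retraction sends it into
    the image of [M]. *)
Lemma AR_inhabited (M : metrizable_space R) : is_AR M -> inhabited M.
Proof.
move=> arM; have [d md] := metrizable_metrizes (metrizableP M).
have [r [_ rM _]] := arM (cone_space d) _ (embedding_cone md) (Zset_cone md).1.
by have [m _ _] := rM (cone_top d).
Qed.

(** Extend in the cone over [M], retract onto the image of [M] by [r], and go back to [M] by the
    inverse [g] of the embedding. *)
Lemma AR_AE (M : metrizable_space R) : is_AR M -> AE R M.
Proof.
move=> arM Z A f cA cf; have [d md] := metrizable_metrizes (metrizableP M).
have ee := embedding_cone md; have ce := embedding_continuous ee.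
have [r [cr rM re]] := arM (cone_space d) _ ee (Zset_cone md).1.
have [|G cG Gf] := @AE_cone _ d Z A (cone_emb md \o f) cA.
  by apply: (@within_comp _ _ _ A setT f (cone_emb md)) => //; exact: continuous_subspaceT.
have [m0] := AR_inhabited arM.
have [|g cg ge] := extend_from_range m0 ee (f := id); first by move=> x; exact: cvg_id.
exists (g \o r \o G) => [|z Az]; last by rewrite /= Gf// re ge.
move=> z; apply: continuous_comp; first exact: cG.
have h : {within setT, continuous (g \o r)}.
  apply: (@within_comp _ _ _ setT (range (cone_emb md)) r g) => //.
  exact: continuous_subspaceT.
by have := h (G z); rewrite /continuous_at /from_subspace nbhs_subspaceT.
Qed.

End embeddings.

(** * Sequences, approaching maps and their homotopies *)

Section sequences.
Variable R : realType.

(** Throughout, a subsequence is given by any [phi] with [n <= phi n]. Monotonicity is not imposed: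
    the inequality already preserves limits, is stable under composition, and is easy to obtain by
    choice. *)
Lemma cvg_subseq (T : topologicalType) (u : nat -> T) (x : T) (phi : nat -> nat) :
  (forall n, (n <= phi n)%N) -> u @ \oo --> x -> u \o phi @ \oo --> x.
Proof.
move=> nphi ux U /ux[N _ NU]; exists N => // n /= Nn.
by apply: NU => /=; exact: leq_trans Nn (nphi n).
Qed.

Lemma subseq_comp (phi psi : nat -> nat) :
  (forall n, (n <= phi n)%N) -> (forall n, (n <= psi n)%N) ->
  forall n, (n <= (phi \o psi) n)%N.
Proof. by move=> h k n; apply: leq_trans (k n) (h _). Qed.

Lemma subseq_cluster (T : topologicalType) (u : nat -> T) (x : T)
    (phi : nat -> nat) :
  (forall n, (n <= phi n)%N) -> u \o phi @ \oo --> x -> cluster (u @ \oo) x.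
Proof.
move=> nphi ux U V [N _ NU] /ux[N' _ NV]; exists (u (phi (maxn N N'))); split.
  by apply: NU => /=; exact: leq_trans (leq_maxl _ _) (nphi _).
by apply: NV => /=; exact: leq_maxr.
Qed.

Lemma seq_choice (T : Type) (P : nat -> T -> Prop) :
  (forall n, exists x, P n x) -> exists u : nat -> T, forall n, P n (u n).
Proof. by move=> h; exists (fun n => projT1 (cid (h n))) => n; case: cid. Qed.

Lemma invS_gt0 n : 0 < n.+1%:R^-1 :> R.
Proof. by rewrite invr_gt0 ltr0Sn. Qed.

Lemma cvg_invS (T : topologicalType) (d : T -> T -> R) (u : nat -> T) (x : T) :
  metrizes d -> (forall n, d x (u n) < n.+1%:R^-1) -> u @ \oo --> x.
Proof.
move=> md ux; apply/(mz_cvg _ _ md) => e e0.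
have [N _ Ne] := near_infty_natSinv_lt (PosNum e0).
by exists N => n /Ne /=; exact: lt_trans.
Qed.

Lemma cluster_subseq (T : topologicalType) (u : nat -> T) (x : T) :
  metrizable R T -> cluster (u @ \oo) x ->
  exists2 phi : nat -> nat, (forall n, (n <= phi n)%N) & u \o phi @ \oo --> x.
Proof.
move=> /metrizable_metrizes[d md] ux.
have [n|phi hphi] := @seq_choice nat
    (fun n k => (n <= k)%N /\ d x (u k) < n.+1%:R^-1).
  have [||_ [[k nk <-] /= xk]] := ux [set u k | k in [set k | (n <= k)%N]]
    [set y | d x y < n.+1%:R^-1]; last by exists k.
  - by exists n => // k nk; exists k.
  - by apply/(mz_nbhs md); exists n.+1%:R^-1 => //; exact: invS_gt0.
exists phi => [n|]; first by case: (hphi n).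
by apply: (cvg_invS md) => n; case: (hphi n).
Qed.

Lemma nbhs_seq (T : topologicalType) (W : set T) (x : T) : metrizable R T ->
  (forall u : nat -> T, u @ \oo --> x -> exists n, W (u n)) -> nbhs x W.
Proof.
move=> /metrizable_metrizes[d md] h; apply: contrapT => nW.
have [n|u hu] := @seq_choice T (fun n y => d x y < n.+1%:R^-1 /\ ~ W y).
  apply: contrapT => /forallNP k; apply: nW; apply/(mz_nbhs md).
  exists n.+1%:R^-1; first exact: invS_gt0.
  by move=> y xy; apply: contrapT => Wy; exact: (k y).
have [|n] := h u; first by apply: (cvg_invS md) => n; case: (hu n).
by case: (hu n).
Qed.

Lemma within_seqP (S T : topologicalType) (D : set S) (f : S -> T) :
  metrizable R S -> {within D, continuous f} <->
  forall (u : nat -> S) x, (forall n, D (u n)) -> D x -> u @ \oo --> x ->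
    f \o u @ \oo --> f x.
Proof.
move=> mS; split=> [/subspace_continuousP cf u x Du Dx ux U fU|h].
  have [N _ NU] := ux _ (cf x Dx U fU).
  by exists N => // n /NU; apply; exact: Du.
apply/subspace_continuousP => x Dx U fU; apply: contrapT => nU.
have [d md] := metrizable_metrizes mS.
have [n|u hu] := @seq_choice S (fun n y => [/\ d x y < n.+1%:R^-1, D y & ~ U (f y)]).
  apply: contrapT => /forallNP k; apply: nU.
  change (nbhs x [set y | D y -> U (f y)]); apply/(mz_nbhs md).
  exists n.+1%:R^-1; first exact: invS_gt0.
  by move=> y xy /= Dy; apply: contrapT => Uy; exact: (k y).
have [||N _ NU] := h u x _ Dx _ U fU.
- by move=> n; case: (hu n).
- by apply: (cvg_invS md) => n; case: (hu n).
by case: (hu N) => _ _; apply; exact: (NU N (leqnn N)).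
Qed.

Lemma continuous_cvg_seq (S T : topologicalType) (f : S -> T) (u : nat -> S) x :
  continuous f -> u @ \oo --> x -> f \o u @ \oo --> f x.
Proof. by move=> cf ux; exact: (continuous_cvg _ (cf x) ux). Qed.

Lemma continuous_withinT (S T : topologicalType) (f : S -> T) :
  {within setT, continuous f} -> continuous f.
Proof.
by move=> cf x; have := cf x; rewrite /continuous_at /from_subspace nbhs_subspaceT.
Qed.

Lemma continuous_seqP (S T : topologicalType) (f : S -> T) :
  metrizable R S -> continuous f <->
  forall (u : nat -> S) x, u @ \oo --> x -> f \o u @ \oo --> f x.
Proof.
move=> mS; split=> [cf u x|h]; first exact: continuous_cvg_seq.
by apply: continuous_withinT; apply/(within_seqP _ _ mS) => u x _ _; exact: h.
Qed.

Lemma cvg_pairE (S T : topologicalType) (u : nat -> S * T) (x : S) (y : T) :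
  u @ \oo --> (x, y) <-> fst \o u @ \oo --> x /\ snd \o u @ \oo --> y.
Proof.
split=> [uxy|[ux uy]].
  by split; [exact: (cvg_comp _ _ uxy cvg_fst)|exact: (cvg_comp _ _ uxy cvg_snd)].
move=> U /(cvg_pair ux uy)[N _ NU]; exists N => // n /NU /=.
by case: (u n).
Qed.

Lemma cvg_pairI (S T : topologicalType) (u : nat -> S) (v : nat -> T) (x : S) (y : T) :
  u @ \oo --> x -> v @ \oo --> y -> (fun n => (u n, v n)) @ \oo --> (x, y).
Proof. by move=> ux vy; exact/cvg_pairE. Qed.

Lemma continuous_pair (S T U : topologicalType) (f : S -> T) (g : S -> U) :
  continuous f -> continuous g -> continuous (fun x => (f x, g x)).
Proof. by move=> cf cg x V /(cvg_pair (cf x) (cg x)). Qed.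

(** Either [P] holds at arbitrarily large indices, or [Q] holds from some [N] on and a shift by [N]
    will do. *)
Lemma subseq_or (T : Type) (P Q : T -> Prop) (u : nat -> T) :
  (forall n, P (u n) \/ Q (u n)) ->
  exists2 phi : nat -> nat, (forall n, (n <= phi n)%N) &
    (forall n, P (u (phi n))) \/ (forall n, Q (u (phi n))).
Proof.
move=> PQ; have [h|/existsNP[N hN]] :=
  pselect (forall N, exists n, (N <= n)%N /\ P (u n)).
  have [phi hphi] := seq_choice h.
  by exists phi => [n|]; [case: (hphi n)|left=> n; case: (hphi n)].
exists (fun n => (N + n)%N) => [n|]; first exact: leq_addl.
right=> n; case: (PQ (N + n)%N) => // Pn; case: hN; exists (N + n)%N.
by split=> //; exact: leq_addr.
Qed.

Lemma within_setU (S T : topologicalType) (D C1 C2 : set S) (f : S -> T) :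
  closed C1 -> closed C2 -> D `<=` C1 `|` C2 ->
  {within D `&` C1, continuous f} -> {within D `&` C2, continuous f} ->
  {within D, continuous f}.
Proof.
move=> cC1 cC2 DC f1 f2; apply/subspace_continuousP => x Dx U fU.
have H C : closed C -> {within D `&` C, continuous f} ->
    nbhs x [set y | D y -> C y -> U (f y)].
  move=> cC /subspace_continuousP cf; have [Cx|nCx] := pselect (C x).
    have := cf x (conj Dx Cx) U fU.
    by apply: (@filterS _ (nbhs x)) => y h Dy Cy; exact: h.
  have := open_nbhs_nbhs (conj (closed_openC cC) nCx : open_nbhs x (~` C)).
  by apply: filterS => y nCy _ /nCy.
change (nbhs x [set y | D y -> U (f y)]).
apply: filterS2 (H C1 cC1 f1) (H C2 cC2 f2) => y h1 h2 Dy.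
by case: (DC _ Dy); [exact: h1|exact: h2].
Qed.

Lemma within_eq (S T : topologicalType) (D : set S) (f g : S -> T) :
  (forall x, D x -> f x = g x) -> {within D, continuous f} ->
  {within D, continuous g}.
Proof.
by move=> fg; apply: subspace_eq_continuous => x; rewrite inE; exact: fg.
Qed.

Lemma unit_itvP (t : R) : @unit_itv R t <-> 0 <= t <= 1.
Proof. by rewrite /unit_itv/= in_itv. Qed.

Lemma unit_itv0 : @unit_itv R 0.
Proof. by apply/unit_itvP; rewrite lexx ler01. Qed.

Lemma unit_itv1 : @unit_itv R 1.
Proof. by apply/unit_itvP; rewrite lexx ler01. Qed.

Lemma unit_itv_clamp (t : R) : @unit_itv R (clamp t).
Proof. exact/unit_itvP/clamp01. Qed.

Lemma clamp_continuous : continuous (@clamp R).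
Proof.
apply: (mz_cts (metrizes_R R) (metrizes_R R)) => x e e0; exists e => // y xy.
by apply: le_lt_trans xy; rewrite ge_min clamp_lip.
Qed.

Lemma closed_unit_itv : closed (@unit_itv R).
Proof. exact: interval_closed. Qed.

Lemma unit_itv_subseq (t : nat -> R) : (forall n, @unit_itv R (t n)) ->
  exists2 phi : nat -> nat, (forall n, (n <= phi n)%N) &
  exists2 s, @unit_itv R s & t \o phi @ \oo --> s.
Proof.
move=> It.
have [|s [Is ts]] := @segment_compact R 0 1 (t @ \oo) _.
  by exists 0%N => // n _; exact: It.
have [phi nphi tphi] := cluster_subseq (metrizable_R R) ts.
by exists phi => //; exists s.
Qed.

End sequences.

(** * Approaching maps through sequences; the calculus of their homotopies *)

Section approaching.
Variable R : realType.
Implicit Types S T U : topologicalType.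

(** With its converse [seq_approaching], this trades cluster points for limits of subsequences,
    which can be extracted one after another. *)
Lemma approaching_seq S T (D A : set S) (B : set T) f :
  metrizable R T -> approaching D A B f ->
  forall (u : nat -> S) a, (forall n, D (u n)) -> A a -> u @ \oo --> a ->
  exists2 phi : nat -> nat, (forall n, (n <= phi n)%N) &
  exists2 b, B b & f \o u \o phi @ \oo --> b.
Proof.
move=> mT [_ _ Af] u a Du Aa ua; have [|b Bb fb] := Af u Du.
  by exists a => //; exact: (@subseq_cluster _ _ _ id).
by have [phi nphi ?] := cluster_subseq mT fb; exists phi => //; exists b.
Qed.

Lemma seq_approaching S T (D A : set S) (B : set T) f :
  metrizable R S -> {within D, continuous f} -> (forall x, D x -> ~ B (f x)) ->
  (forall (u : nat -> S) a, (forall n, D (u n)) -> A a -> u @ \oo --> a ->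
   exists2 phi : nat -> nat, (forall n, (n <= phi n)%N) &
   exists2 b, B b & f \o u \o phi @ \oo --> b) ->
  approaching D A B f.
Proof.
move=> mS cf Df h; split=> // u Du [a Aa /(cluster_subseq mS)[phi nphi ua]].
have [psi npsi [b Bb fb]] := h (u \o phi) a (fun n => Du _) Aa ua.
exists b => //; exact: (subseq_cluster (subseq_comp nphi npsi)).
Qed.

Lemma approaching_eq S T (D A : set S) (B : set T) f g :
  (forall x, D x -> f x = g x) -> approaching D A B f -> approaching D A B g.
Proof.
move=> fg [cf Df Af]; split; first exact: within_eq cf.
  by move=> x Dx; rewrite -fg//; exact: Df.
move=> u Du /(Af u Du)[b Bb fb]; exists b => //.
by rewrite (_ : g \o u = f \o u)//; apply/funext => n /=; rewrite fg.
Qed.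

Lemma approaching_trans S T U (D A : set S) (E B : set T) (C : set U) f g :
  (forall x, D x -> E (f x)) -> approaching D A B f -> approaching E B C g ->
  approaching D A C (g \o f).
Proof.
move=> DE [cf Df Af] [cg Eg Ag]; split.
- exact: within_comp cg.
- by move=> x /DE/Eg.
- by move=> u Du /(Af _ Du); apply: Ag => n; exact/DE/Du.
Qed.

Lemma approaching_precomp S S' T (D A : set S) (D' A' : set S') (B : set T) f
    (g : S' -> S) : continuous g ->
  (forall x, D' x -> D (g x)) -> (forall x, A' x -> A (g x)) ->
  metrizable R S' -> approaching D A B f -> approaching D' A' B (f \o g).
Proof.
move=> cg DD' AA' mS' [cf Df Af]; split.
- by apply: (within_comp DD') cf; exact: continuous_subspaceT.
- by move=> x /DD'/Df.
move=> u Du [a Aa /(cluster_subseq mS')[phi nphi ua]].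
apply: (Af (g \o u)) => [n|]; first exact/DD'/Du.
exists (g a); first exact: AA'.
by apply: (subseq_cluster nphi); exact: (continuous_cvg_seq cg ua).
Qed.

(** The main source of approaching maps: restrictions of maps that are continuous everywhere. *)
Lemma approaching_continuous S T (D A : set S) (B : set T) f :
  metrizable R S -> continuous f -> (forall x, D x -> ~ B (f x)) ->
  (forall x, A x -> B (f x)) -> approaching D A B f.
Proof.
move=> mS cf Df Af; apply: seq_approaching => //.
  exact: continuous_subspaceT.
move=> u a Du Aa ua; exists id => //; exists (f a); first exact: Af.
exact: continuous_cvg_seq.
Qed.

Lemma approaching_setU S T (D C1 C2 A : set S) (B : set T) f :
  metrizable R S -> metrizable R T ->
  closed C1 -> closed C2 -> D `<=` C1 `|` C2 ->
  approaching (D `&` C1) A B f -> approaching (D `&` C2) A B f ->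
  approaching D A B f.
Proof.
move=> mS mT cC1 cC2 DC f1 f2; apply: seq_approaching => //.
- by apply: (within_setU cC1 cC2 DC); [case: f1|case: f2].
- move=> x Dx; case: (DC x Dx) => Cx.
    by case: f1 => _ /(_ x (conj Dx Cx)).
  by case: f2 => _ /(_ x (conj Dx Cx)).
move=> u a Du Aa ua; have [phi nphi C] := subseq_or (fun n => DC _ (Du n)).
have uphi := cvg_subseq nphi ua.
have [psi npsi H] : exists2 psi : nat -> nat, (forall n, (n <= psi n)%N) &
    exists2 b, B b & f \o (u \o phi) \o psi @ \oo --> b.
  case: C => C; [apply: (approaching_seq mT f1 _ Aa uphi)
                |apply: (approaching_seq mT f2 _ Aa uphi)] => n;
    by split; [exact: Du|exact: C].
by exists (phi \o psi) => //; exact: subseq_comp.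
Qed.

(** With [D] everything and [A], [B] empty this is ordinary homotopy; with [D] the complement of [A]
    it is approaching homotopy. The equivalence and composition laws are thus proved once for
    both. *)
Definition htp S T (D A : set S) (B : set T) (f g : S -> T) : Prop :=
  exists h : S * R -> T,
    [/\ approaching (D `*` @unit_itv R) (A `*` @unit_itv R) B h,
        (forall x, D x -> h (x, 0) = f x) & (forall x, D x -> h (x, 1) = g x)].

Section htp.
Variables (S T : topologicalType) (D A : set S) (B : set T).
Hypotheses (mS : metrizable R S) (mT : metrizable R T).

Let mSR : metrizable R (S * R)%type.
Proof. exact: (metrizable_prod mS (metrizable_R R)). Qed.

Lemma htp_eq f g f' g' : (forall x, D x -> f x = f' x) ->
  (forall x, D x -> g x = g' x) -> htp D A B f g -> htp D A B f' g'.
Proof.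
move=> ff gg [h [ah h0 h1]]; exists h; split=> // x Dx.
  by rewrite h0// ff.
by rewrite h1// gg.
Qed.

Lemma htp_refl f : approaching D A B f -> htp D A B f f.
Proof.
move=> af; exists (f \o fst); split=> //.
by apply: (approaching_precomp _ _ _ _ af) => //;
  [move=> x; exact: cvg_fst|move=> x []|move=> x []].
Qed.

(** Affine changes of time, clamped: they serve to reverse and concatenate homotopies and to extend
    them to all real times. *)
Lemma reparam_continuous (a b : R) :
  continuous (fun p : S * R => (p.1, clamp (a * p.2 + b))).
Proof.
apply: continuous_pair => p; first exact: cvg_fst.
have ca : continuous (fun p : S * R => a * p.2 + b).
  by move=> q; apply: cvgD; [apply: cvgMr; exact: cvg_snd|exact: cvg_cst].
exact: (continuous_comp (ca p) (@clamp_continuous R _)).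
Qed.

Lemma htp_sym f g : htp D A B f g -> htp D A B g f.
Proof.
move=> [h [ah h0 h1]]; exists (h \o (fun p => (p.1, clamp (- 1 * p.2 + 1)))); split.
- apply: (approaching_precomp (@reparam_continuous _ _) _ _ _ ah) => //.
    by move=> x [Dx _]; split=> //; exact: unit_itv_clamp.
  by move=> x [Dx _]; split=> //; exact: unit_itv_clamp.
- by move=> x Dx /=; rewrite mulr0 add0r clamp_id ?lexx ?ler01// h1.
- by move=> x Dx /=; rewrite mulr1 addrC subrr clamp_id ?lexx ?ler01// h0.
Qed.

Lemma htp_trans g f k : htp D A B f g -> htp D A B g k -> htp D A B f k.
Proof.
move=> [h [ah h0 h1]] [h' [ah' h0' h1']].
pose H (p : S * R) := if p.2 <= 2^-1 then h (p.1, clamp (2 * p.2 + 0))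
                      else h' (p.1, clamp (2 * p.2 + - 1)).
have cs : continuous (@snd S R) by move=> x; exact: cvg_snd.
exists H; split; last 2 first.
- by move=> x Dx; rewrite /H/= invr_ge0 ler0n mulr0 add0r clamp_id ?lexx ?ler01 ?h0.
- move=> x Dx; rewrite /H/= ifF; last by apply/negbTE; rewrite -ltNge; lra.
  have -> : 2 * 1 + - 1 = 1 :> R by lra.
  by rewrite clamp_id ?lexx ?ler01 ?h1'.
apply: (@approaching_setU _ _ (D `*` @unit_itv R) (snd @^-1` [set t | t <= 2^-1])
   (snd @^-1` [set t | 2^-1 <= t]) (A `*` @unit_itv R) B H) => //.
- by apply: closed_comp => [p _|]; [exact: cs|exact: closed_le].
- by apply: closed_comp => [p _|]; [exact: cs|exact: closed_ge].
- by move=> p _ /=; case: (leP p.2 2^-1) => ?; [left|right; exact: ltW].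
- apply: (approaching_eq (f := h \o (fun p => (p.1, clamp (2 * p.2 + 0))))).
    by move=> p [_ /= p2]; rewrite /H p2.
  apply: (approaching_precomp (@reparam_continuous _ _) _ _ _ ah) => //.
    by move=> x [[Dx _] _]; split=> //; exact: unit_itv_clamp.
  by move=> x [Dx _]; split=> //; exact: unit_itv_clamp.
- apply: (approaching_eq (f := h' \o (fun p => (p.1, clamp (2 * p.2 + - 1))))).
    move=> [x t] [[/= Dx _] p2]; rewrite /H/=; case: ifPn => // p2'.
    have -> : t = 2^-1 by apply: le_anti; rewrite p2'.
    have -> : 2 * 2^-1 + - 1 = 0 :> R by lra.
    have -> : 2 * 2^-1 + 0 = 1 :> R by lra.
    by rewrite !clamp_id ?lexx ?ler01 ?h1 ?h0'.
  apply: (approaching_precomp (@reparam_continuous _ _) _ _ _ ah') => //.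
    by move=> x [[Dx _] _]; split=> //; exact: unit_itv_clamp.
  by move=> x [Dx _]; split=> //; exact: unit_itv_clamp.
Qed.

Lemma htp_compl U (E : set T) (C : set U) (f g : S -> T) (k : T -> U) :
  ~` B `<=` E -> approaching E B C k -> htp D A B f g ->
  htp D A C (k \o f) (k \o g).
Proof.
move=> BE ak [h [ah h0 h1]]; exists (k \o h); split.
- by apply: (approaching_trans _ ah ak) => x Dx; apply: BE; case: ah => _ /(_ x Dx).
- by move=> x Dx /=; rewrite h0.
- by move=> x Dx /=; rewrite h1.
Qed.

Lemma htp_compr S' (D' A' : set S') (f g : S -> T) (k : S' -> S) :
  metrizable R S' -> (forall x, D' x -> D (k x)) -> approaching D' A' A k ->
  htp D A B f g -> htp D' A' B (f \o k) (g \o k).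
Proof.
move=> mS' Dk ak [h [ah h0 h1]].
exists (h \o (fun p => (k p.1, p.2))); split; last 2 first.
- by move=> x /Dk Dx /=; rewrite h0.
- by move=> x /Dk Dx /=; rewrite h1.
have mSR' := metrizable_prod mS' (metrizable_R R).
have DD : forall x, (D' `*` @unit_itv R) x -> (D `*` @unit_itv R) (k x.1, x.2).
  by move=> x [/Dk ? ?]; split.
have ck : {within D' `*` @unit_itv R, continuous (fun p => (k p.1, p.2))}.
  apply/(within_seqP _ _ mSR') => u [x t] Du [/= Dx _] /cvg_pairE[ux ut].
  have [/(within_seqP _ _ mS')ck _ _] := ak.
  apply: (cvg_pairI (u := fun n => k (u n).1) (v := fun n => (u n).2)) => //.
  by apply: (ck _ _ _ Dx ux) => n; case: (Du n).
apply: seq_approaching => //.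
- by apply: (within_comp DD ck); case: ah.
- by move=> x /DD Dx; case: ah => _ /(_ _ Dx).
move=> u [x t] Du [/= Ax It] /cvg_pairE[ux ut].
(* Two extractions: first [k] is made to converge to some [b] in [A], then [h] is used at the limit
   [(b, t)]. *)
have [n|phi nphi [b Ab kb]] := approaching_seq mS ak _ Ax ux; first by case: (Du n).
have [|//||psi npsi [c Bc hc]] := approaching_seq mT ah (u := fun n =>
   (k (u (phi n)).1, (u (phi n)).2)) (a := (b, t)).
- by move=> n; exact/DD/Du.
- exact: (cvg_pairI kb (cvg_subseq nphi ut)).
- by exists (phi \o psi); [exact: subseq_comp|exists c].
Qed.

End htp.

(** Clamping the time makes the homotopy of [is_Zset] continuous on the whole product with the line,
    so it can be composed with positive functions without care for their range. *)
Lemma Zset_push (M : topologicalType) (X : set M) : is_Zset R X ->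
  exists h : M * R -> M, [/\ continuous h, (forall m, h (m, 0) = m) &
    (forall m t, 0 < t -> ~ X (h (m, t)))].
Proof.
move=> [_ [h [ch h0 hX]]]; exists (h \o (fun p => (p.1, clamp (1 * p.2 + 0)))); split.
- apply: continuous_withinT.
  apply: (within_comp (B := setT `*` @unit_itv R)) => //.
    by move=> x _; split=> //; exact: unit_itv_clamp.
  by apply: continuous_subspaceT; exact: reparam_continuous.
- by move=> m /=; rewrite mulr0 addr0 clamp_id ?lexx ?ler01.
- move=> m t t0 /=; apply: hX; rewrite mul1r addr0 clamp_gt0//=.
  by case/andP: (clamp01 t).
Qed.

Lemma distance_function (T : topologicalType) (C : set T) :
  metrizable R T -> closed C -> exists D : T -> R,
  [/\ continuous D, (forall x, C x -> D x = 0), (forall x, ~ C x -> 0 < D x)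
    & forall x, 0 <= D x <= 1].
Proof.
move=> /metrizable_metrizes[d md] cC.
have [D [D01 D0 Dtri _ _]] := distance_to md cC; exists D; split=> //.
- exact: lipschitz_continuous md Dtri.
- by move=> x /D0.
- by move=> x nCx; rewrite lt_neqAle (andP (D01 x)).1 andbT eq_sym; apply/eqP => /D0.
Qed.

(** A homotopy given on [X] and the two ends [F], [G] form a map on a closed subset [C] of the
    product of [M] with the line. It extends because [N] is an absolute extensor, and the extension
    is pushed off [Y] by the distance to [C], which changes nothing on [C]. *)
Lemma htp_extend (M N : metrizable_space R) (X : set M) (Y : set N)
    (F G : M -> N) (k : M * R -> N) :
  AE R N -> closed X -> is_Zset R Y -> continuous F -> continuous G ->
  {within X `*` @unit_itv R, continuous k} ->
  (forall x, X x -> k (x, 0) = F x) -> (forall x, X x -> k (x, 1) = G x) ->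
  (forall x t, X x -> @unit_itv R t -> Y (k (x, t))) ->
  (forall x, ~ X x -> ~ Y (F x)) -> (forall x, ~ X x -> ~ Y (G x)) ->
  htp (~` X) X Y F G.
Proof.
move=> aeN cX zY cF cG ck k0 k1 kY FY GY.
have mMR := metrizable_prod (metrizableP M) (metrizable_R R).
have [push [cp p0 pY]] := Zset_push zY.
(* The ends take precedence over [k]; on [X] the three prescriptions agree by the hypotheses on
   [k]. *)
pose K (p : M * R) := if p.2 == 0 then F p.1 else if p.2 == 1 then G p.1 else k p.
have cset (a : R) : closed (snd @^-1` [set a] : set (M * R)).
  apply: closed_comp => [p _|]; first exact: cvg_snd.
  exact: accessible_closed_set1 (hausdorff_accessible (@norm_hausdorff _ R)) _.
have cXI : closed (X `*` @unit_itv R).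
  have -> : X `*` @unit_itv R = fst @^-1` X `&` snd @^-1` @unit_itv R by [].
  apply: closedI; apply: closed_comp => //; last exact: closed_unit_itv.
    by move=> p _; exact: cvg_fst.
  by move=> p _; exact: cvg_snd.
pose C := (X `*` @unit_itv R) `|` (snd @^-1` [set 0]) `|` (snd @^-1` [set 1]).
have cC : closed C by do 2 apply: closedU => //.
have cK : {within C, continuous K}.
  apply: withinU_continuous => //; first exact: closedU.
    apply: withinU_continuous => //.
      apply: within_eq ck => -[x t] /= [Xx It]; rewrite /K/=.
      case: eqP => [->|_]; first exact: k0.
      by case: eqP => [->|//]; exact: k1.
    apply: (within_eq (f := F \o fst)) => [[x t] /= ->|]; first by rewrite /K/= eqxx.
    by apply: continuous_subspaceT => p; apply: continuous_comp; [exact: cvg_fst|exact: cF].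
  apply: (within_eq (f := G \o fst)) => [[x t] /= ->|]; first by rewrite /K/= oner_eq0 eqxx.
  by apply: continuous_subspaceT => p; apply: continuous_comp; [exact: cvg_fst|exact: cG].
have [K' cK' K'K] := aeN (MetrizableSpace mMR) C K cC cK.
have [D [cD D0 Dgt _]] := distance_function mMR cC.
have ch : continuous (fun p => push (K' p, D p)).
  have cKD := continuous_pair cK' cD.
  by move=> p; exact: (continuous_comp (cKD p) (cp _)).
have hC p : C p -> push (K' p, D p) = K p.
  by move=> Cp; rewrite D0// p0 K'K.
exists (fun p => push (K' p, D p)); split.
- apply: approaching_continuous => //.
    move=> p [Xp _]; have [Cp|nCp] := pselect (C p); last exact/pY/Dgt.
    rewrite hC// /K; case: eqP => [_|p20]; first exact: FY.
    case: eqP => [_|p21]; first exact: GY.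
    by case: Cp => [[[]|]|].
  move=> [x t] [/= Xx It]; rewrite hC; last by left; left; split.
  rewrite /K/=; case: eqP => [t0|_]; first by rewrite -k0// -t0; exact: kY.
  by case: eqP => [t0|_]; [rewrite -k1// -t0|]; exact: kY.
- by move=> x _; rewrite hC /K/= ?eqxx//; left; right.
- by move=> x _; rewrite hC /K/= ?oner_eq0 ?eqxx//; right.
Qed.

End approaching.

(** * The homotopy category, the fine shape category and the functor *)

Section quotient.
Variables (T : Type) (E : T -> T -> Prop).
Hypotheses (Er : forall x, E x x) (Es : forall x y, E x y -> E y x)
  (Et : forall x y z, E x y -> E y z -> E x z).

Lemma class_eqP x y : class E x = class E y <-> E x y.
Proof.
split=> [/(congr1 (@proj1_sig _ _))/= ->|xy]; first exact: Er.
apply: eq_exist; apply/funext => z; apply/propext; split=> [xz|yz].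
  exact: Et (Es xy) xz.
exact: Et xy yz.
Qed.
End quotient.

Lemma classP (T : Type) (E : T -> T -> Prop) (p : quotient E) :
  exists x, p = class E x.
Proof. by case: p => A [x Ax]; exists x; exact: eq_exist. Qed.

Section categories.
Variable R : realType.

Lemma homotopicP (X Y : topologicalType) (f g : continuousType X Y) :
  homotopic R f g <-> htp R setT set0 set0 f g.
Proof.
split=> [[h [ch h0 h1]]|[h [[ch _ _] h0 h1]]]; exists h; split=> //.
- by split=> [||u _ [a [[] _] _]] //; move=> x _ [].
- by move=> x; exact: h0.
- by move=> x; exact: h1.
Qed.

Lemma approaching_set0 (X Y : topologicalType) (f : X -> Y) :
  continuous f -> approaching setT set0 set0 f.
Proof.
by move=> cf; split=> [|x _ []|u _ [a []]]; exact: continuous_subspaceT.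
Qed.

Section htpy_equiv.
Variables X Y : metrizable_space R.
Implicit Types f g h : continuousType X Y.

Lemma homotopic_refl f : homotopic R f f.
Proof.
apply/homotopicP/htp_refl; rewrite //; first exact: metrizableP.
exact/approaching_set0/cts_fun.
Qed.

Lemma homotopic_sym f g : homotopic R f g -> homotopic R g f.
Proof. by move=> /homotopicP fg; apply/homotopicP; exact: (htp_sym (metrizableP X) fg). Qed.

Lemma homotopic_trans g f h :
  homotopic R f g -> homotopic R g h -> homotopic R f h.
Proof.
move=> /homotopicP fg /homotopicP gh; apply/homotopicP.
exact: (htp_trans (metrizableP X) (metrizableP Y) fg gh).
Qed.

Lemma htpy_classP f g : htpy_class f = htpy_class g <-> homotopic R f g.
Proof.
apply: class_eqP; [exact: homotopic_refl|exact: homotopic_sym|].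
by move=> x y z; exact: homotopic_trans.
Qed.

Lemma htpy_hom_ex (p : htpy_hom X Y) : exists f, p = htpy_class f.
Proof. exact: classP. Qed.

Definition htpy_repr (p : htpy_hom X Y) : continuousType X Y :=
  projT1 (cid (htpy_hom_ex p)).

Lemma htpy_reprK p : htpy_class (htpy_repr p) = p.
Proof. by rewrite /htpy_repr; case: cid => /= f ->. Qed.

End htpy_equiv.

Lemma homotopic_comp (X Y Z : metrizable_space R) (f f' : continuousType X Y)
    (g g' : continuousType Y Z) : homotopic R f f' -> homotopic R g g' ->
  homotopic R (g \o f : continuousType X Z) (g' \o f' : continuousType X Z).
Proof.
move=> /homotopicP ff /homotopicP gg.
apply: (@homotopic_trans _ _ (g \o f' : continuousType X Z)); apply/homotopicP.
  apply: (htp_compl (E := setT) _ _ ff) => //; exact/approaching_set0/cts_fun.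
apply: (htp_compr (metrizableP Y) (metrizableP Z) (metrizableP X) _ _ gg) => //.
exact/approaching_set0/cts_fun.
Qed.

Definition htpy_comp_hom (X Y Z : metrizable_space R) (q : htpy_hom Y Z)
    (p : htpy_hom X Y) : htpy_hom X Z :=
  htpy_class (htpy_repr q \o htpy_repr p : continuousType X Z).

Lemma htpy_comp_class (X Y Z : metrizable_space R) (g : continuousType Y Z)
    (f : continuousType X Y) :
  htpy_comp_hom (htpy_class g) (htpy_class f) =
  htpy_class (g \o f : continuousType X Z).
Proof.
by apply/htpy_classP/homotopic_comp; apply/htpy_classP; rewrite htpy_reprK.
Qed.

Definition htpy_category_on : category_on (@htpy_hom R).
Proof.
refine (@Category _ _ (fun X : metrizable_space R => htpy_class (@idfun X : continuousType X X))
  htpy_comp_hom _ _ _).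
- move=> X Y p; have [f ->] := htpy_hom_ex p; rewrite htpy_comp_class.
  exact/htpy_classP/homotopic_refl.
- move=> X Y p; have [f ->] := htpy_hom_ex p; rewrite htpy_comp_class.
  exact/htpy_classP/homotopic_refl.
- move=> W X Y Z r q p; have [h ->] := htpy_hom_ex r.
  have [g ->] := htpy_hom_ex q; have [f ->] := htpy_hom_ex p.
  by rewrite !htpy_comp_class; exact/htpy_classP/homotopic_refl.
Defined.

Definition homotopy_cat : homotopy_category R :=
  @HomotopyCategory R htpy_category_on (fun=> erefl) htpy_comp_class.

Section approaching_maps.
Variables (X Y Z W : topologicalType).
Variables (M : AR_Zembedding R X) (N : AR_Zembedding R Y).
Variables (L : AR_Zembedding R Z) (K : AR_Zembedding R W).
Implicit Types f g h : approaching_map M N.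

Let mM := metrizableP (ar_space M).
Let mN := metrizableP (ar_space N).

Lemma ah_refl f : approaching_homotopic f f.
Proof. exact: (htp_refl mM (amapP f)). Qed.

Lemma ah_sym f g : approaching_homotopic f g -> approaching_homotopic g f.
Proof. exact: (htp_sym mM). Qed.

Lemma ah_trans g f h : approaching_homotopic f g ->
  approaching_homotopic g h -> approaching_homotopic f h.
Proof. exact: (htp_trans mM mN). Qed.

Lemma ah_compl (k : approaching_map N L) f g : approaching_homotopic f g ->
  approaching_homotopic (amap_comp k f) (amap_comp k g).
Proof. exact: (htp_compl _ (amapP k)). Qed.

Lemma ah_compr (k : approaching_map K M) f g : approaching_homotopic f g ->
  approaching_homotopic (amap_comp f k) (amap_comp g k).
Proof.
apply: (htp_compr mM mN (metrizableP (ar_space K)) _ (amapP k)).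
by case: (amapP k).
Qed.

(** Existence of phi_MN: extend [N \o phi] from the image of [X] to all of [M], then push off [Y] by
    the distance to [X]. *)
Lemma combines_ex (phi : X -> Y) : continuous phi ->
  exists f : approaching_map M N, combines phi f.
Proof.
move=> cphi; have eM := zemb_embedding M; have cM := (zemb_Zset M).1.
have cN := embedding_continuous (zemb_embedding N).
have [n0] := AR_inhabited (@ar_spaceP _ _ N).
have cNphi : continuous (N \o phi).
  by move=> x; apply: continuous_comp; [exact: cphi|exact: cN].
have [g cg gM] := extend_from_range n0 eM cNphi.
have [F cF Fg] := AR_AE (@ar_spaceP _ _ N) cM cg.
have [push [cp p0 pN]] := Zset_push (zemb_Zset N).
have [D [cD D0 Dgt _]] := distance_function mM cM.
pose G m := push (F m, D m).
have cG : continuous G.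
  have cFD := continuous_pair cF cD.
  by move=> m; exact: (continuous_comp (cFD m) (cp _)).
have GX x : G (M x) = N (phi x).
  have Mx : range M (M x) by exists x.
  by rewrite /G D0// p0 Fg// gM.
have aG : approaching (~` range M) (range M) (range N) G.
  apply: (approaching_continuous mM cG) => [m nXm|_ [x _ <-]]; first exact/pN/Dgt.
  by rewrite GX; exists (phi x).
by exists (ApproachingMap aG), G.
Qed.

(** Uniqueness of phi_MN, stated for homotopic maps so that it also shows that the functor is well
    defined on homotopy classes. *)
Lemma combines_homotopic (phi psi : continuousType X Y)
    (f g : approaching_map M N) :
  homotopic R phi psi -> combines phi f -> combines psi g ->
  approaching_homotopic f g.
Proof.
move=> [k [ck k0 k1]] [F [cF Ff FX]] [G [cG Gg GX]].
suff : htp R (~` range M) (range M) (range N) F G by apply: htp_eq.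
have eM := zemb_embedding M; have cM := (zemb_Zset M).1.
have FN m : ~ range M m -> ~ range N (F m).
  by move=> nXm; rewrite Ff//; case: (amapP f) => _ /(_ m nXm).
have GN m : ~ range M m -> ~ range N (G m).
  by move=> nXm; rewrite Gg//; case: (amapP g) => _ /(_ m nXm).
(* The inverse [inv] of the embedding needs a default point [x0]; for empty [X] the conditions on
   [X] are vacuous and any [k] continuous there serves. *)
have [[x0 _]|X0] := pselect (exists x : X, True); last first.
  have XX (x : X) : False by apply: X0; exists x.
  apply: (htp_extend (k := F \o fst) (AR_AE (@ar_spaceP _ _ N)) cM (zemb_Zset N) cF cG).
  - by apply: continuous_subspaceT => p; apply: continuous_comp;
      [exact: cvg_fst|exact: cF].
  - by [].
  - by move=> x [y _ _]; case: (XX y).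
  - by move=> x t [y _ _]; case: (XX y).
  - exact: FN.
  - exact: GN.
have [|inv cinv invM] := extend_from_range x0 eM (f := id).
  by move=> x; exact: cvg_id.
apply: (htp_extend (k := N \o (k \o (fun p => (inv p.1, p.2))))
  (AR_AE (@ar_spaceP _ _ N)) cM (zemb_Zset N) cF cG).
- have mMR := metrizable_prod mM (metrizable_R R).
  apply: (within_comp (B := setT)) => //; last first.
    apply: continuous_subspaceT.
    exact/embedding_continuous/zemb_embedding.
  apply: (within_comp (B := setT `*` @unit_itv R) _ _ ck) => [p []//|].
  apply/(within_seqP _ _ mMR) => u [x t] Du [/= Xx _] /cvg_pairE[ux ut].
  apply: (cvg_pairI (u := fun n => inv (u n).1) (v := fun n => (u n).2)) => //.
  move/(within_seqP _ _ mM) : cinv => /(_ (fun n => (u n).1) x); apply=> // n.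
  by case: (Du n).
- by move=> _ [x _ <-] /=; rewrite invM k0 FX.
- by move=> _ [x _ <-] /=; rewrite invM k1 GX.
- by move=> _ t [x _ <-] _ /=; rewrite invM; exists (k (x, t)).
- exact: FN.
- exact: GN.
Qed.

Lemma combines_comp (phi : X -> Y) (psi : Y -> Z) (f : approaching_map M N)
    (g : approaching_map N L) :
  combines phi f -> combines psi g -> combines (psi \o phi) (amap_comp g f).
Proof.
move=> [F [cF Ff FX]] [G [cG Gg GX]]; exists (G \o F); split.
- by move=> m; apply: continuous_comp; [exact: cF|exact: cG].
- move=> m nXm /=; rewrite Ff// Gg//.
  by case: (amapP f) => _ /(_ m nXm).
- by move=> x /=; rewrite FX GX.
Qed.

Lemma combines_id : combines idfun (amap_id M).
Proof. by exists idfun; split=> // m; exact: cvg_id. Qed.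

End approaching_maps.

(** * Fine shape morphisms and independence of the chosen ARs *)

Section fish.
Variables X Y : metrizable_space R.

Lemma combines_id_unique (Z : metrizable_space R) (M M' : AR_Zembedding R Z)
    (i j : approaching_map M M') :
  combines idfun i -> combines idfun j -> approaching_homotopic i j.
Proof.
apply: (@combines_homotopic _ _ _ _ (@idfun Z : continuousType Z Z)
  (@idfun Z : continuousType Z Z)).
exact: homotopic_refl.
Qed.

Lemma combines_id_ex (Z : metrizable_space R) (M M' : AR_Zembedding R Z) :
  exists i : approaching_map M M', combines idfun i.
Proof. by apply: combines_ex => x; exact: cvg_id. Qed.

Lemma combines_idK (Z : metrizable_space R) (M M' : AR_Zembedding R Z)
    (i : approaching_map M M') (j : approaching_map M' M) :
  combines idfun i -> combines idfun j ->
  approaching_homotopic (amap_comp j i) (amap_id M).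
Proof.
move=> ci cj; apply: combines_id_unique; last exact: combines_id.
exact: (combines_comp ci cj).
Qed.

(** The maps combining with the identity are unique up to approaching homotopy, so equivalence can
    be tested with any choice of them. *)
Lemma fish_equivP (M M' : AR_Zembedding R X) (N N' : AR_Zembedding R Y)
    (f : approaching_map M N) (g : approaching_map M' N')
    (i : approaching_map M M') (j : approaching_map N N') :
  combines idfun i -> combines idfun j ->
  fish_equiv (FishRep f) (FishRep g) <->
  approaching_homotopic (amap_comp j f) (amap_comp g i).
Proof.
move=> ci cj; split=> [[i' [j' [/= ci' cj' h]]]|h]; last by exists i, j.
apply: (ah_trans (ah_compr f (combines_id_unique cj cj'))).
apply: (ah_trans h); exact: (ah_compl g (combines_id_unique ci' ci)).
Qed.

Lemma fish_equiv_refl (p : fish_rep X Y) : fish_equiv p p.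
Proof.
by exists (amap_id _), (amap_id _); split; [exact: combines_id|exact: combines_id|
  exact: ah_refl].
Qed.

(** The transition maps in the two directions are mutually inverse up to homotopy; composing the
    given homotopy with [j'] and [i'] reverses the square. *)
Lemma fish_equiv_sym (p q : fish_rep X Y) : fish_equiv p q -> fish_equiv q p.
Proof.
case: p q => [M N f] [M' N' g] [i [j [/= ci cj h]]].
have [i' ci'] := combines_id_ex M' M; have [j' cj'] := combines_id_ex N' N.
exists i', j'; split=> //=.
apply: (@ah_trans _ _ _ _ (amap_comp j' (amap_comp (amap_comp g i) i'))).
  apply: (ah_compl j' (g := amap_comp g (amap_comp i i')) _).
  apply: (ah_compl g (f := amap_id M') _).
  exact/ah_sym/combines_idK.
apply: (@ah_trans _ _ _ _ (amap_comp j' (amap_comp (amap_comp j f) i'))).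
  exact/(ah_compl j')/(ah_compr i')/ah_sym.
exact: (ah_compr i' (ah_compr f (combines_idK cj cj'))).
Qed.

Lemma fish_equiv_trans (p q r : fish_rep X Y) :
  fish_equiv p q -> fish_equiv q r -> fish_equiv p r.
Proof.
case: p q r => [M N f] [M' N' g] [M'' N'' h] [i [j [/= ci cj fg]]]
  [i' [j' [/= ci' cj' gh]]].
exists (amap_comp i' i), (amap_comp j' j); split=> /=.
- exact: (combines_comp ci ci').
- exact: (combines_comp cj cj').
- exact: (ah_trans (ah_compl j' fg) (ah_compr i gh)).
Qed.

Lemma fish_classP (M M' : AR_Zembedding R X) (N N' : AR_Zembedding R Y)
    (f : approaching_map M N) (g : approaching_map M' N') :
  fish_class f = fish_class g <-> fish_equiv (FishRep f) (FishRep g).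
Proof.
apply: class_eqP; [exact: fish_equiv_refl|exact: fish_equiv_sym|].
exact: fish_equiv_trans.
Qed.

Lemma fish_class_homotopicP (M : AR_Zembedding R X) (N : AR_Zembedding R Y)
    (f g : approaching_map M N) :
  fish_class f = fish_class g <-> approaching_homotopic f g.
Proof.
apply: (iff_trans (fish_classP f g)).
exact: (fish_equivP f g (combines_id M) (combines_id N)).
Qed.

Lemma fish_class_combines (phi psi : continuousType X Y)
    (M M' : AR_Zembedding R X) (N N' : AR_Zembedding R Y)
    (f : approaching_map M N) (g : approaching_map M' N') :
  homotopic R phi psi -> combines phi f -> combines psi g ->
  fish_class f = fish_class g.
Proof.
move=> pp cf cg; have [i ci] := combines_id_ex M M'.
have [j cj] := combines_id_ex N N'.
apply/fish_classP/(fish_equivP f g ci cj).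
apply: (combines_homotopic pp); first exact: (combines_comp cf cj).
exact: (combines_comp ci cg).
Qed.

(** Composition with transition maps on both sides moves a representative to any prescribed pair of
    ARs. This supplies the common middle AR for composition. *)
Lemma fish_hom_ex (p : fish_hom X Y) (M : AR_Zembedding R X)
    (N : AR_Zembedding R Y) :
  exists f : approaching_map M N, p = fish_class f.
Proof.
have [[M' N' f] ->] := classP p.
have [i ci] := combines_id_ex M M'; have [i' ci'] := combines_id_ex M' M.
have [j cj] := combines_id_ex N' N.
exists (amap_comp j (amap_comp f i)).
apply/fish_classP/(fish_equivP f _ ci' cj).
apply: (ah_compl j (f := f) (g := amap_comp f (amap_comp i i')) _).
apply: (ah_compl f (f := amap_id M') _).
exact/ah_sym/combines_idK.
Qed.

Definition fish_repr (p : fish_hom X Y) (M : AR_Zembedding R X)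
  (N : AR_Zembedding R Y) : approaching_map M N :=
  projT1 (cid (fish_hom_ex p M N)).

Lemma fish_reprK p (M : AR_Zembedding R X) (N : AR_Zembedding R Y) :
  fish_class (fish_repr p M N) = p.
Proof. by rewrite /fish_repr; case: cid => /= f ->. Qed.

End fish.

Definition canonical_AR (X : metrizable_space R) : AR_Zembedding R X.
Proof. by have [d md] := cid (metrizable_metrizes (metrizableP X)); exact: cone_AR md. Qed.

Definition fish_comp_hom (X Y Z : metrizable_space R) (q : fish_hom Y Z)
    (p : fish_hom X Y) : fish_hom X Z :=
  fish_class (amap_comp (fish_repr q (canonical_AR Y) (canonical_AR Z))
                        (fish_repr p (canonical_AR X) (canonical_AR Y))).

(** The transition maps pass one factor at a time: [l g0 f0] is homotopic to [g j f0], and this to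
    [g f i]. *)
Lemma fish_comp_class (X Y Z : metrizable_space R) (M : AR_Zembedding R X)
    (N : AR_Zembedding R Y) (L : AR_Zembedding R Z)
    (g : approaching_map N L) (f : approaching_map M N) :
  fish_comp_hom (fish_class g) (fish_class f) = fish_class (amap_comp g f).
Proof.
rewrite /fish_comp_hom; set g0 := fish_repr _ _ _; set f0 := fish_repr _ _ _.
have [i ci] := combines_id_ex (canonical_AR X) M.
have [j cj] := combines_id_ex (canonical_AR Y) N.
have [l cl] := combines_id_ex (canonical_AR Z) L.
have hf : approaching_homotopic (amap_comp j f0) (amap_comp f i).
  by apply/(fish_equivP f0 f ci cj)/fish_classP; rewrite fish_reprK.
have hg : approaching_homotopic (amap_comp l g0) (amap_comp g j).
  by apply/(fish_equivP g0 g cj cl)/fish_classP; rewrite fish_reprK.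
apply/fish_classP/(fish_equivP (amap_comp g0 f0) (amap_comp g f) ci cl).
exact: (ah_trans (ah_compr f0 hg) (ah_compl g hf)).
Qed.

Definition fish_category_on : category_on (@fish_hom R).
Proof.
refine (@Category _ _ (fun X => fish_class (amap_id (canonical_AR X)))
  fish_comp_hom _ _ _).
- move=> X Y p; have [f ->] := fish_hom_ex p (canonical_AR X) (canonical_AR Y).
  by rewrite fish_comp_class; exact/fish_class_homotopicP/ah_refl.
- move=> X Y p; have [f ->] := fish_hom_ex p (canonical_AR X) (canonical_AR Y).
  by rewrite fish_comp_class; exact/fish_class_homotopicP/ah_refl.
- move=> W X Y Z r q p.
  have [h ->] := fish_hom_ex r (canonical_AR Y) (canonical_AR Z).
  have [g ->] := fish_hom_ex q (canonical_AR X) (canonical_AR Y).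
  have [f ->] := fish_hom_ex p (canonical_AR W) (canonical_AR X).
  by rewrite !fish_comp_class; exact/fish_class_homotopicP/ah_refl.
Defined.

Lemma fish_id_class (X : metrizable_space R) (M : AR_Zembedding R X) :
  fish_class (amap_id (canonical_AR X)) = fish_class (amap_id M).
Proof.
apply: (@fish_class_combines _ _ (@idfun X : continuousType X X)
  (@idfun X : continuousType X X)); [exact: homotopic_refl|exact: combines_id|].
exact: combines_id.
Qed.

Definition fish_category : fine_shape_category R :=
  @FineShapeCategory R fish_category_on fish_id_class fish_comp_class.

Definition fish_functor (X Y : metrizable_space R) (p : htpy_hom X Y) :
    fish_hom X Y :=
  fish_class (projT1 (cid (combines_ex (canonical_AR X) (canonical_AR Y)
                            (@cts_fun _ _ (htpy_repr p))))).

Lemma fish_functor_class (X Y : metrizable_space R) (phi : continuousType X Y)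
    (M : AR_Zembedding R X) (N : AR_Zembedding R Y) (f : approaching_map M N) :
  combines phi f -> fish_functor (htpy_class phi) = fish_class f.
Proof.
move=> cf; rewrite /fish_functor; case: cid => g /= cg.
have h : homotopic R (htpy_repr (htpy_class phi)) phi.
  by apply/htpy_classP; rewrite htpy_reprK.
exact (fish_class_combines h cg cf).
Qed.

Lemma fish_functor_functorial : functorial homotopy_cat fish_category fish_functor.
Proof.
split=> [X|X Y Z q p] /=.
  exact/fish_functor_class/combines_id.
have [g ->] := htpy_hom_ex q; have [f ->] := htpy_hom_ex p.
have [F cF] := combines_ex (canonical_AR X) (canonical_AR Y) (@cts_fun _ _ f).
have [G cG] := combines_ex (canonical_AR Y) (canonical_AR Z) (@cts_fun _ _ g).
rewrite htpy_comp_class (fish_functor_class cF) (fish_functor_class cG).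
by rewrite fish_comp_class; exact: (fish_functor_class (combines_comp cF cG)).
Qed.

End categories.

(** * Fine shape morphisms to an ANR *)

Section ANR.
Variable R : realType.

Lemma cvg_seq2 (S T U : topologicalType) (h : S * T -> U) (u : nat -> S)
    (v : nat -> T) (x : S) (y : T) : continuous h ->
  u @ \oo --> x -> v @ \oo --> y -> (fun n => h (u n, v n)) @ \oo --> h (x, y).
Proof. by move=> ch ux vy; exact: (continuous_cvg_seq ch (cvg_pairI ux vy)). Qed.

Lemma continuous2 (S T U V : topologicalType) (h : T * U -> V) (f : S -> T)
    (g : S -> U) : continuous h -> continuous f -> continuous g ->
  continuous (fun x => h (f x, g x)).
Proof.
move=> ch cf cg x; have cfg := continuous_pair cf cg.
exact: (continuous_comp (cfg x) (ch _)).
Qed.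

Section continuous_of.
Variables (X Y : topologicalType) (f : X -> Y) (cf : continuous f).
(** The proof [cf] remains an argument of the alias, so that the structure of a continuous map can
    be inferred from it. *)
Definition continuous_of : X -> Y := let _ := cf in f.
HB.instance Definition _ := @isContinuous.Build X Y continuous_of cf.
End continuous_of.

Lemma embedding_lift (S Y N : topologicalType) (e : Y -> N) (g : S -> N) :
  embedding e -> continuous g -> (forall x, range e (g x)) ->
  exists f : continuousType S Y, forall x, e (f x) = g x.
Proof.
move=> ee cg eg.
have H x : exists y, e y = g x by have [y _ ?] := eg x; exists y.
pose f x := projT1 (cid (H x)).
have ef x : e (f x) = g x by rewrite /f; case: cid.
have cf : continuous f.
  move=> x U fU; have [V Vx VU] := embedding_nbhs ee fU.
  rewrite ef in Vx; have gV : nbhs x (g @^-1` V) := cg x V Vx.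
  apply: (filterS _ gV) => y /= Vy.
  by apply: VU; rewrite /= ef.
by exists (continuous_of cf : continuousType S Y).
Qed.

(** The deformation is prescribed on a closed set: the identity at time 0, stationary on [Y], and
    the neighbourhood retraction [r] at time 1 on a closed neighbourhood of [Y]. Being an absolute
    extensor, [N] allows an extension to all points and times. *)
Lemma ANR_retraction (Y N : metrizable_space R) (e : Y -> N) :
  is_ANR Y -> AE R N -> embedding e -> closed (range e) ->
  exists (U : set N) (l : N * R -> N),
    [/\ open U, range e `<=` U, continuous l, (forall n, l (n, 0) = n) &
     (forall y t, unit_itv t -> l (e y, t) = e y) /\
     (forall n, U n -> range e (l (n, 1)))].
Proof.
move=> anrY aeN ee ce; have mN := metrizableP N.
have [U0 [r [oU0 eU0 cr rU0 re]]] := anrY N e ee ce.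
have [D0 [cD0 D0z D0p D001]] := distance_function mN (open_closedC oU0).
have [DY [cDY DYz DYp DY01]] := distance_function mN ce.
have cDD : continuous (fun n => D0 n - DY n).
  by move=> n; apply: cvgB; [exact: cD0|exact: cDY].
(* A closed neighbourhood of [Y] inside [U0]: where the function vanishing off [U0] is at least the
   one vanishing on [Y]. Its strict version is the open set returned. *)
pose C1 := [set n | 0 <= D0 n - DY n].
have cC1 : closed C1 by apply: closed_comp (@closed_ge R 0) => n _; exact: cDD.
have C1U : C1 `<=` U0.
  move=> n /= h; apply: contrapT => nU.
  suff /eU0 : range e n by [].
  by apply: contrapT => /DYp; have := D0z n nU; move: h; rewrite /C1/=; lra.
have eU y : 0 < D0 (e y) - DY (e y).
  rewrite DYz ?subr0; last by exists y.
  by apply: D0p => nU; apply/nU/eU0; exists y.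
have rY n : range e n -> r n = n by move=> [y _ <-].
have mNR := metrizable_prod mN (metrizable_R R).
pose K (p : N * R) := if p.2 == 0 then p.1 else if p.2 == 1 then r p.1 else p.1.
have cfst : continuous (@fst N R) by move=> p; exact: cvg_fst.
have csnd : continuous (@snd N R) by move=> p; exact: cvg_snd.
have cset (a : R) : closed (snd @^-1` [set a] : set (N * R)).
  apply: closed_comp => [p _|]; first exact: csnd.
  exact: accessible_closed_set1 (hausdorff_accessible (@norm_hausdorff _ R)) _.
have cYI : closed (range e `*` @unit_itv R).
  have -> : range e `*` @unit_itv R = fst @^-1` range e `&` snd @^-1` @unit_itv R by [].
  by apply: closedI; apply: closed_comp => //; exact: closed_unit_itv.
have cC1' : closed (fst @^-1` C1 `&` snd @^-1` [set 1] : set (N * R)).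
  by apply: closedI => //; apply: closed_comp => // p _; exact: cfst.
pose C := (range e `*` @unit_itv R) `|` (snd @^-1` [set 0]) `|`
  (fst @^-1` C1 `&` snd @^-1` [set 1]).
have cC : closed C by do 2 apply: closedU => //.
have cK : {within C, continuous K}.
  apply: withinU_continuous => //; first exact: closedU.
    apply: withinU_continuous => //.
      apply: (within_eq (f := fst)); last exact: continuous_subspaceT.
      move=> [n t] /= [Yn It]; rewrite /K/=.
      by case: eqP => // _; case: eqP => // _; rewrite rY.
    apply: (within_eq (f := fst)); last exact: continuous_subspaceT.
    by move=> [n t] /= ->; rewrite /K/= eqxx.
  apply: (within_eq (f := r \o fst)).
    by move=> [n t] /= [_ ->]; rewrite /K/= oner_eq0 eqxx.
  by apply: (within_comp _ _ cr) => [[n t] [/C1U]//|]; exact: continuous_subspaceT.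
have [l cl lK] := aeN (MetrizableSpace mNR) C K cC cK.
exists [set n | 0 < D0 n - DY n], l; split=> //.
- by apply: open_comp (@open_gt R 0) => n _; exact: cDD.
- by move=> _ [y _ <-]; exact: eU.
- by move=> n; rewrite lK /K/= ?eqxx//; left; right.
split=> [y t It|n Un].
  rewrite lK; last by left; left; split=> //; exists y.
  by rewrite /K/=; case: eqP => // _; case: eqP => // _; rewrite re.
have C1n : C1 n by exact: ltW.
rewrite lK; last by right.
rewrite /K/= oner_eq0 eqxx; exact/rU0/C1U.
Qed.

Lemma Zset_collar (M : metrizable_space R) (X W : set M) :
  is_Zset R X -> (forall x, X x -> nbhs x W) ->
  exists (h : M * R -> M) (tau : M -> R),
    [/\ continuous h, (forall m, h (m, 0) = m),
        (forall m t, 0 < t -> ~ X (h (m, t))) & continuous tau] /\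
    [/\ (forall m, 0 <= tau m), (forall x, X x -> 0 < tau x) &
        (forall m s, 0 < tau m -> 0 <= s <= tau m -> W (h (m, s)))].
Proof.
move=> zX XW; have [h [ch h0 hX]] := Zset_push zX.
have [d md] := metrizable_metrizes (metrizableP M).
have mdR := metrizes_prod md (metrizes_R R).
pose O := [set p : M * R | W (h p)].
have [D [D01 D0 Dtri _ _]] := distance_to mdR (@closed_closure _ (~` O)).
have cD : continuous D := lipschitz_continuous mdR Dtri.
have Dlip m s : 0 <= s -> D (m, 0) <= s + D (m, s).
  move=> s0; apply: (le_trans (Dtri (m, 0) (m, s))).
  rewrite lerD2r /= (mz_refl md) sub0r normrN ger0_norm// ge_max s0.
  by rewrite ge_min lexx.
have D0' p : D p = 0 \/ 0 < D p.
  have /andP[+ _] := D01 p; rewrite le_eqVlt => /orP[/eqP <-|]; first by left.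
  by right.
exists h, (fun m => D (m, 0) / 2); split; split=> //.
- move=> m; apply: cvgMl; apply: (continuous_comp (f := fun m => (m, 0))); last exact: cD.
  by apply: continuous_pair => [x|x]; [exact: cvg_id|exact: cvg_cst].
- by move=> m; rewrite divr_ge0//; case/andP: (D01 (m, 0)).
- move=> x Xx; rewrite divr_gt0//; case: (D0' (x, 0)) => // /D0 cl.
  have xW : nbhs (h (x, 0)) W by rewrite h0; exact: XW.
  by have [p [nO /nO]] := cl _ (ch (x, 0) W xW).
- move=> m s t0 /andP[s0 st]; apply: contrapT => nW.
  have : D (m, s) = 0 by apply/D0/subset_closure.
  by have := Dlip m s s0; lra.
Qed.

(** Otherwise there are points off [X] tending to [x], and times, whose images avoid [U]. By
    compactness of [0, 1] the times converge along a subsequence, so some images converge to a point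
    of [Y], which lies in the open set [U]. *)
Lemma approaching_htp_nbhs (M N : topologicalType) (X : set M) (Y U : set N)
    (H : M * R -> N) x :
  metrizable R M -> metrizable R N -> X x -> open U -> Y `<=` U ->
  approaching (~` X `*` @unit_itv R) (X `*` @unit_itv R) Y H ->
  nbhs x [set m | ~ X m -> forall s, unit_itv s -> U (H (m, s))].
Proof.
move=> mM mN Xx oU YU aH; apply: (nbhs_seq mM) => u ux; apply: contrapT.
move=> /forallNP nU.
have [n|s us] := @seq_choice R (fun n s =>
    [/\ ~ X (u n), unit_itv s & ~ U (H (u n, s))]).
  move/not_implyP: (nU n) => [nX /existsNP[s /not_implyP[Is nUs]]].
  by exists s.
have [|phi nphi [t It st]] := @unit_itv_subseq R s; first by move=> n; case: (us n).
have [|||psi npsi [b /YU Ub Hb]] := approaching_seq mN aH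
    (u := fun n => (u (phi n), s (phi n))) (a := (x, t)).
- by move=> n; case: (us (phi n)).
- by [].
- exact: (cvg_pairI (cvg_subseq nphi ux) st).
have [k _ kU] := Hb U (open_nbhs_nbhs (conj oU Ub)).
by case: (us (phi (psi k))) => _ _; apply; exact: (kU k (leqnn k)).
Qed.

(** * Approaching maps into an AR containing an ANR as a Z-set *)

Section representation.
Variables (X Y : metrizable_space R) (M : AR_Zembedding R X) (N : AR_Zembedding R Y).
Hypothesis anrY : is_ANR Y.

Let mM := metrizableP (ar_space M).
Let mN := metrizableP (ar_space N).
Let cM := (zemb_Zset M).1.
Let cN := (zemb_Zset N).1.
Let ctsM := embedding_continuous (zemb_embedding M).
Let ctsN := embedding_continuous (zemb_embedding N).

Lemma combines_surjective (Phi : approaching_map M N) :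
  exists (phi : continuousType X Y) (f : approaching_map M N),
    combines phi f /\ approaching_homotopic Phi f.
Proof.
have aPhi := amapP Phi.
have [U [l [oU NU cl l0 [lY lU]]]] :=
  ANR_retraction anrY (AR_AE (@ar_spaceP _ _ N)) (zemb_embedding N) cN.
have [pN [cpN pN0 pNY]] := Zset_push (zemb_Zset N).
have [D [cD D0 Dgt D01]] := distance_function mM cM.
have aPhi1 : approaching (~` range M `*` @unit_itv R) (range M `*` @unit_itv R)
    (range N) (Phi \o fst).
  apply: (approaching_precomp _ _ _ (metrizable_prod mM (metrizable_R R)) aPhi).
  - by move=> p; exact: cvg_fst.
  - by move=> p [].
  - by move=> p [].
pose W := [set m | ~ range M m -> U (Phi m)].
have XW x : range M x -> nbhs x W.
  move=> Xx; have := approaching_htp_nbhs mM mN Xx oU NU aPhi1.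
  by apply: filterS => m h /h /(_ 0 (@unit_itv0 R)).
have [h [tau [[ch h0 hX ctau] [tau0 tauX hW]]]] := Zset_collar (zemb_Zset M) XW.
have [cPhi PhiY Phiapp] := aPhi.
(* Where [tau m = 0] nothing moves, but such [m] is off [X]; where [tau m > 0] any positive [s]
   pushes off [X]. *)
have hXs m s : 0 <= s -> (~ range M m \/ 0 < s) -> ~ range M (h (m, s * tau m)).
  move=> s0 mX; have := tau0 m; rewrite le_eqVlt => /orP[/eqP t0|t0].
    rewrite -t0 mulr0 h0; case: mX => // _ /tauX; rewrite -t0 ltxx//.
  move: s0; rewrite le_eqVlt => /orP[/eqP s0|s0]; last exact/hX/mulr_gt0.
  by rewrite -s0 mul0r h0; case: mX => //; rewrite -s0 ltxx.
have UW x s : range M x -> 0 < s <= 1 -> U (Phi (h (x, s * tau x))).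
  move=> Xx /andP[s0 s1]; have t0 := tauX x Xx.
  have := hW x (s * tau x) t0; apply; last by apply: hXs; [exact: ltW|right].
  by apply/andP; split; [exact: mulr_ge0 (ltW s0) (ltW t0)|rewrite ger_pMl].
(* [J1] applies the deformation [l]; its push off [Y] grows from 0, since [Phi] itself must be
   recovered at time 0. [J2] then inserts the homotopy [h] under a constant push by [D], needed
   because [l] at time 1 may land in [Y]. *)
pose J1 (p : ar_space M * R) := pN (l (Phi p.1, p.2), p.2 * D p.1).
pose J2 (p : ar_space M * R) := pN (l (Phi (h (p.1, p.2 * tau p.1)), 1), D p.1).
have mMR := metrizable_prod mM (metrizable_R R).
have gt0D m : ~ range M m -> 0 < D m by exact: Dgt.
have rM x : range M (M x) by exists x.
have cD' (u : nat -> ar_space M) x : u @ \oo --> x -> D \o u @ \oo --> D x.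
  exact: continuous_cvg_seq.
have cPhis (u : nat -> ar_space M) x : (forall n, ~ range M (u n)) ->
    ~ range M x -> u @ \oo --> x -> Phi \o u @ \oo --> Phi x.
  by move/(within_seqP _ _ mM) : cPhi; exact.
have cht (u : nat -> ar_space M) (v : nat -> R) (x : ar_space M) (s : R) :
    u @ \oo --> x -> v @ \oo --> s ->
    (fun n => h (u n, v n * tau (u n))) @ \oo --> h (x, s * tau x).
  move=> ux vs; apply: cvg_seq2 => //; apply: cvgM => //.
  exact: (continuous_cvg_seq ctau ux).
have H1 : htp R (~` range M) (range M) (range N) Phi (fun m => J1 (m, 1)).
  exists J1; split=> //; last first.
    by move=> m nXm; rewrite /J1/= mul0r pN0 l0.
  apply: (seq_approaching mMR).
  - apply/(within_seqP _ J1 mMR) => u [m s] Du [/= nXm _] /cvg_pairE[um us].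
    apply: (cvg_seq2 cpN).
      by apply: (cvg_seq2 cl) us; apply: cPhis => // n; case: (Du n).
    exact: cvgM us (cD' _ _ um).
  - move=> [m s] [/= nXm /unit_itvP/andP[]]; rewrite le_eqVlt.
    move=> /orP[/eqP <-|s0] _; rewrite /J1/=.
      by rewrite mul0r pN0 l0; exact: PhiY.
    by apply: pNY; rewrite mulr_gt0// gt0D.
  move=> u [x s] Du [/= Xx Is] /cvg_pairE[ux us].
  have [n|phi nphi [_ [y _ <-] Phib]] := approaching_seq mN aPhi _ Xx ux.
    by case: (Du n).
  exists phi => //; exists (N y); first by exists y.
  have -> : N y = pN (l (N y, s), s * D x) by rewrite D0// mulr0 pN0 lY.
  apply: (cvg_seq2 cpN).
    exact: (cvg_seq2 cl Phib (cvg_subseq nphi us)).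
  exact: cvgM (cvg_subseq nphi us) (cvg_subseq nphi (cD' _ _ ux)).
have H2 : htp R (~` range M) (range M) (range N) (fun m => J1 (m, 1))
    (fun m => J2 (m, 1)).
  exists J2; split=> //; last first.
    by move=> m nXm; rewrite /J1 /J2/= mul0r h0 mul1r.
  apply: (seq_approaching mMR).
  - apply/(within_seqP _ J2 mMR) => u [m s] Du [/= nXm Is] /cvg_pairE[um us].
    apply: (cvg_seq2 cpN); last exact: (cD' _ _ um).
    apply: (cvg_seq2 cl); last exact: cvg_cst.
    apply: cPhis; last exact: cht.
      move=> n; case: (Du n) => nXn /unit_itvP/andP[s0 _].
      by apply: hXs => //; left.
    by apply: hXs; [case/unit_itvP/andP: Is|left].
  - by move=> [m s] [/= nXm _]; exact/pNY/gt0D.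
  move=> u [x s] Du [/= Xx /unit_itvP/andP[]].
  have nXu n : ~ range M (h ((u n).1, (u n).2 * tau (u n).1)).
    case: (Du n) => nXn /unit_itvP/andP[s0 _].
    by apply: hXs => //; left.
  (* At limit time 0 the points [h] still tend to [X], and the approaching property of [Phi]
     applies. At a positive time their limit is off [X], and the continuity of [Phi] suffices. *)
  rewrite le_eqVlt => /orP[/eqP <- _|s0 s1] /cvg_pairE[ux us].
    have := cht _ _ _ _ ux us; rewrite mul0r h0 => hux.
    have [//|phi nphi [_ [y _ <-] Phib]] := approaching_seq mN aPhi _ Xx hux.
    exists phi => //; exists (N y); first by exists y.
    have -> : N y = pN (l (N y, 1), D x).
      by rewrite D0// pN0 lY//; exact: unit_itv1.
    apply: (cvg_seq2 cpN); last exact: (cvg_subseq nphi (cD' _ _ ux)).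
    by apply: (cvg_seq2 cl Phib); exact: cvg_cst.
  exists id => //; exists (pN (l (Phi (h (x, s * tau x)), 1), D x)).
    by rewrite D0// pN0; apply: lU; apply: UW => //; rewrite s0.
  apply: (cvg_seq2 cpN); last exact: (cD' _ _ ux).
  apply: (cvg_seq2 cl); last exact: cvg_cst.
  apply: cPhis => //; last exact: cht.
  by apply: hXs; [exact: ltW|right].
(* At time 1 the argument of [Phi] is off [X] for every [m], including those in [X]; hence [F] is
   continuous on all of [M]. *)
pose F m := J2 (m, 1).
have cF : continuous F.
  apply/(continuous_seqP _ mM) => u m um.
  apply: (cvg_seq2 cpN); last exact: (cD' _ _ um).
  apply: (cvg_seq2 cl); last exact: cvg_cst.
  apply: cPhis => [n||]; [by apply: hXs; rewrite ?ler01//; right; exact: ltr01..|].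
  by apply: cht => //; exact: cvg_cst.
have FY x : range N (F (M x)).
  rewrite /F /J2 /= D0// pN0; apply: lU; apply: UW => //.
  by rewrite lexx ltr01.
have [||phi phiF] := @embedding_lift _ _ _ N (F \o M) (zemb_embedding N).
- by move=> x; apply: continuous_comp; [exact: ctsM|exact: cF].
- exact: FY.
have aF : approaching (~` range M) (range M) (range N) F.
  apply: (approaching_continuous mM cF) => [m nXm|_ [x _ <-]]; last exact: FY.
  exact/pNY/gt0D.
exists phi, (ApproachingMap aF); split.
  by exists F; split=> // x; rewrite phiF.
exact: (htp_trans mM mN H1 H2).
Qed.

(** The approaching homotopy [H], evaluated at the pushed points of [X] and retracted to [Y], is a
    homotopy [k] of maps from [X] to [Y]. Its ends are joined to [phi] and [psi] by shrinking the
    push to zero. *)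
Lemma combines_injective (phi psi : continuousType X Y)
    (f g : approaching_map M N) :
  combines phi f -> combines psi g -> approaching_homotopic f g ->
  homotopic R phi psi.
Proof.
move=> [F [cF Ff FM]] [G [cG Gg GM]] [H [aH H0 H1]].
have [U [l [oU NU cl l0 [lY lU]]]] :=
  ANR_retraction anrY (AR_AE (@ar_spaceP _ _ N)) (zemb_embedding N) cN.
pose W := [set m | ~ range M m -> forall s : R, unit_itv s -> U (H (m, s))].
have XW x : range M x -> nbhs x W.
  by move=> Xx; exact: (approaching_htp_nbhs mM mN Xx oU NU aH).
have [h [tau [[ch h0 hX ctau] [tau0 tauX hW]]]] := Zset_collar (zemb_Zset M) XW.
have mXR := metrizable_prod (metrizableP X) (metrizable_R R).
have mMR := metrizable_prod mM (metrizable_R R).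
have rM x : range M (M x) by exists x.
have tauM x : 0 < tau (M x) by exact: tauX.
have UW x s t : 0 < s <= 1 -> unit_itv t -> U (H (h (M x, s * tau (M x)), t)).
  move=> /andP[s0 s1] It; apply: hW => //.
    apply/andP; split; last by rewrite ger_pMl.
    exact: mulr_ge0 (ltW s0) (ltW (tauM x)).
  exact/hX/mulr_gt0.
have nXh x s : 0 < s -> ~ range M (h (M x, s * tau (M x))).
  by move=> s0; exact/hX/mulr_gt0.
have ctauM : continuous (tau \o M).
  by move=> x; apply: continuous_comp; [exact: ctsM|exact: ctau].
have cl1 : continuous (fun n => l (n, 1)).
  by apply: (continuous2 cl) => x; [exact: cvg_id|exact: cvg_cst].
pose A (p : X * R) := l (H (h (M p.1, tau (M p.1)), clamp p.2), 1).
have cA : continuous A.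
  apply/(continuous_seqP _ mXR) => u [x s] /cvg_pairE[ux us].
  apply: (continuous_cvg_seq cl1
    (u := fun n => H (h (M (u n).1, tau (M (u n).1)), clamp (u n).2))).
  have [/(within_seqP _ _ mMR) cH _ _] := aH.
  apply: (cH (fun n => (h (M (u n).1, tau (M (u n).1)), clamp (u n).2))).
  - by move=> n; split=> /=; [exact: hX|exact: unit_itv_clamp].
  - by split=> /=; [exact: hX|exact: unit_itv_clamp].
  - apply: cvg_pairI; last exact: (continuous_cvg_seq (@clamp_continuous R) us).
    apply: (cvg_seq2 ch); first exact: (continuous_cvg_seq ctsM ux).
    exact: (continuous_cvg_seq ctauM ux).
have AY p : range N (A p).
  apply: lU; rewrite -[tau _]mul1r; apply: UW; last exact: unit_itv_clamp.
  by rewrite ltr01 lexx.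
have [k kA] := embedding_lift (zemb_embedding N) cA AY.
have ck := @cts_fun _ _ k.
have cslice (t : R) : continuous (fun x : X => k (x, t)).
  move=> x; apply: (continuous_comp (f := fun x : X => (x, t)) _ (ck _)).
  by apply: continuous_pair => [y|y]; [exact: cvg_id|exact: cvg_cst].
pose k0 : continuousType X Y := continuous_of (cslice 0).
pose k1 : continuousType X Y := continuous_of (cslice 1).
(* The time [t] of [H] is frozen at an end, where [H] extends continuously over [X] as [K]; only the
   amount of push varies. *)
have main (chi : continuousType X Y) (K : ar_space M -> ar_space N) t
    (kt : continuousType X Y) : unit_itv t -> continuous K ->
    (forall m, ~ range M m -> K m = H (m, t)) ->
    (forall x, K (M x) = N (chi x)) -> (forall x, kt x = k (x, t)) ->
    homotopic R chi kt.
  move=> It cK KH KM ktE.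
  pose B (p : X * R) := l (K (h (M p.1, clamp p.2 * tau (M p.1))), 1).
  have cB : continuous B.
    apply/(continuous_seqP _ mXR) => u [x s] /cvg_pairE[ux us].
    apply: (continuous_cvg_seq cl1
      (u := fun n => K (h (M (u n).1, clamp (u n).2 * tau (M (u n).1))))).
    apply: (continuous_cvg_seq cK
      (u := fun n => h (M (u n).1, clamp (u n).2 * tau (M (u n).1)))).
    apply: (cvg_seq2 ch); first exact: (continuous_cvg_seq ctsM ux).
    apply: cvgM; first exact: (continuous_cvg_seq (@clamp_continuous R) us).
    exact: (continuous_cvg_seq ctauM ux).
  have BY p : range N (B p).
    rewrite /B; have /andP[] := clamp01 p.2; rewrite le_eqVlt => /orP[/eqP <- _|s0 s1].
      rewrite mul0r h0 KM lY; first by exists (chi p.1).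
      exact: unit_itv1.
    by apply: lU; rewrite KH; [apply: UW => //; rewrite s0|exact: nXh].
  have [b bB] := embedding_lift (zemb_embedding N) cB BY.
  have iN := (zemb_embedding N).1; have It' : 0 <= t <= 1 by move/unit_itvP: It.
  exists b; split.
  - by apply: continuous_subspaceT; exact: cts_fun.
  - move=> x; apply: iN; rewrite bB /B/= clamp_id ?lexx ?ler01//.
    by rewrite mul0r h0 KM lY//; exact: unit_itv1.
  - move=> x; apply: iN; rewrite bB ktE kA /A /B/= !clamp_id ?lexx ?ler01//.
    by rewrite mul1r KH//; exact: hX.
have p0 : homotopic R phi k0.
  apply: (main phi F 0) => //; first exact: unit_itv0.
  by move=> m nXm; rewrite Ff// H0.
have p1 : homotopic R psi k1.
  apply: (main psi G 1) => //; first exact: unit_itv1.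
  by move=> m nXm; rewrite Gg// H1.
apply: (homotopic_trans p0); apply: (homotopic_trans _ (homotopic_sym p1)).
exists k; split=> //; exact: continuous_subspaceT.
Qed.

End representation.

Lemma fish_functor_bijective (X Y : metrizable_space R) :
  is_ANR Y -> bijective (@fish_functor R X Y).
Proof.
move=> anrY; have M := canonical_AR X; have N := canonical_AR Y.
have inj : injective (@fish_functor R X Y).
  move=> p q; have [phi ->] := htpy_hom_ex p; have [psi ->] := htpy_hom_ex q.
  have [f cf] := combines_ex M N (@cts_fun _ _ phi).
  have [g cg] := combines_ex M N (@cts_fun _ _ psi).
  rewrite (fish_functor_class cf) (fish_functor_class cg).
  move=> /fish_class_homotopicP fg; apply/htpy_classP.
  exact: (combines_injective anrY cf cg fg).
have surj (q : fish_hom X Y) : exists p, fish_functor p = q.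
  have [Phi ->] := fish_hom_ex q M N.
  have [phi [f [cf Pf]]] := combines_surjective anrY Phi.
  exists (htpy_class phi); rewrite (fish_functor_class cf).
  exact/fish_class_homotopicP/ah_sym.
exists (fun q => projT1 (cid (surj q))) => [p|q]; last by case: cid.
by apply: inj; case: cid.
Qed.

End ANR.

(** * The Hilbert cube and strong shape of compacta *)

Section compact.
Variable R : realType.

Lemma closed_seq (T : topologicalType) (C : set T) : metrizable R T ->
  (forall (u : nat -> T) x, (forall n, C (u n)) -> u @ \oo --> x -> C x) ->
  closed C.
Proof.
move=> mT h x Cx; have [d md] := metrizable_metrizes mT.
have [n|u hu] := @seq_choice T (fun n y => C y /\ d x y < n.+1%:R^-1).
  have [|y [Cy xy]] := Cx [set y | d x y < n.+1%:R^-1]; last by exists y.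
  by apply/(mz_nbhs md); exists n.+1%:R^-1 => //; exact: invS_gt0.
apply: (h u) => [n|]; first by case: (hu n).
by apply: (cvg_invS md) => n; case: (hu n).
Qed.

Lemma closed_cvg_seq (T : topologicalType) (C : set T) (u : nat -> T) (x : T) :
  closed C -> (forall n, C (u n)) -> u @ \oo --> x -> C x.
Proof. by move=> cC Cu; apply: (closed_cvg C cC); exists 0%N => // n _; exact: Cu. Qed.

(** If [f] is proper and points of [D] tend to [A], their images cluster in the compact [T]; a
    cluster point off [B] has a compact neighbourhood off [B], whose compact preimage would contain
    a point of [A]. Conversely, a limit in [A] of points in the preimage of a compact [K] off [B]
    would yield a point of both [K] and [B], so such limits stay in [D]. *)
Lemma proper_approachingP (S T : topologicalType) (D A : set S) (B : set T)
    (f : S -> T) :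
  metrizable R S -> metrizable R T -> compact [set: T] -> closed B ->
  compact (D `|` A) -> (forall x, D x -> ~ A x) ->
  Defs.proper D B f <-> approaching D A B f.
Proof.
move=> mS mT cT cB cDA DA.
have [dS mdS] := metrizable_metrizes mS; have hS := mz_hausdorff mdS.
split=> [[cf Df Kf]|aF].
  apply: (seq_approaching mS) => // u a Du Aa ua.
  have [|b [_ fb]] := cT ((f \o u) @ \oo) _; first by exists 0%N.
  have [phi nphi fphi] := cluster_subseq mT fb.
  exists phi => //; exists b => //; apply: contrapT => nBb.
  have [D' [cD' D'0 D'gt _]] := distance_function mT cB.
  (* At least half the value at [b] of a function vanishing on [B]: a closed neighbourhood of [b]
     missing [B]. *)
  pose K := [set y | D' b / 2 <= D' y].
  have cK : closed K by apply: closed_comp (@closed_ge R _) => y _; exact: cD'.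
  have KB : K `<=` ~` B.
    by move=> y; rewrite /K/= => h /D'0 h0; have := D'gt _ nBb; lra.
  have nK : nbhs b K.
    have : open [set y | D' b / 2 < D' y].
      by apply: open_comp (@open_gt R _) => y _; exact: cD'.
    move=> oK; apply: (@filterS _ (nbhs b) _ [set y | D' b / 2 < D' y]).
      by move=> y /ltW.
    by apply: open_nbhs_nbhs; split=> //=; have := D'gt _ nBb; lra.
  have cKf := Kf K KB (subclosed_compact cK cT (fun _ _ => I)).
  have [N _ NK] := fphi K nK.
  have : (D `&` f @^-1` K) a.
    apply: (closed_cvg_seq (u := u \o (fun n => phi (N + n)%N)) (compact_closed hS cKf)).
      by move=> n; split; [exact: Du|apply: NK => /=; exact: leq_addr].
    apply: (cvg_subseq _ ua) => n; apply: leq_trans (nphi _); exact: leq_addl.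
  by move=> [/DA].
case: (aF) => cf Df _; split=> // K KB cK.
have [dT mdT] := metrizable_metrizes mT.
have clK := compact_closed (mz_hausdorff mdT) cK.
apply: (subclosed_compact _ cDA); last by move=> x [Dx _]; left.
apply: (closed_seq mS) => u a Ku ua.
have [Da|Aa] : (D `|` A) a.
    by apply: (closed_cvg_seq (compact_closed hS cDA) _ ua) => n; left; case: (Ku n).
  split=> //; apply: (closed_cvg_seq clK (u := f \o u)) => [n|]; first by case: (Ku n).
  move/(within_seqP _ _ mS) : cf; apply=> // n; by case: (Ku n).
have [n|phi nphi [b Bb fb]] := approaching_seq mT aF _ Aa ua; first by case: (Ku n).
suff /KB/(_ Bb) : K b by [].
by apply: (closed_cvg_seq clK _ fb) => n; case: (Ku (phi n)).
Qed.

Lemma compact_embedding (S T : topologicalType) (e : S -> T) :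
  compact [set: S] -> hausdorff_space T -> continuous e -> injective e ->
  embedding e.
Proof.
move=> cS hT ce ie; apply: embeddingP => // x U; rewrite nbhsE => -[V [oV Vx] VU].
have cK : closed (e @` (~` V)).
  apply: compact_closed => //; apply: continuous_compact.
    exact: continuous_subspaceT.
  exact: (subclosed_compact (open_closedC oV) cS).
exists (~` (e @` (~` V))).
  by apply: open_nbhs_nbhs; split; [exact: closed_openC|move=> [y nVy /ie yx];
     apply: nVy; rewrite yx].
by move=> y /= h; apply: VU; apply: contrapT => nVy; apply: h; exists y.
Qed.

Lemma compact_range (S T : topologicalType) (e : S -> T) :
  compact [set: S] -> hausdorff_space T -> continuous e -> closed (range e).
Proof.
move=> cS hT ce; apply: compact_closed => //; apply: continuous_compact => //.
exact: continuous_subspaceT.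
Qed.

Lemma embedding_metrizable (S T : topologicalType) (e : S -> T) :
  embedding e -> metrizable R T -> metrizable R S.
Proof.
move=> ee /metrizable_metrizes[d md].
apply: (@metrizes_metrizable R S (fun x y => d (e x) (e y))); split.
- by move=> x; exact: mz_refl.
- by move=> x y /(mz_eq md)/ee.1.
- by move=> x y; exact: mz_sym.
- by move=> y x z; exact: mz_triangle.
- by move=> x y; exact: mz_le1.
move=> x U; split=> [xU|[r r0 rU]].
  have [V /(mz_nbhs md)[r r0 rV] VU] := embedding_nbhs ee xU.
  by exists r => // y /rV/VU.
have : nbhs (e x) [set z | d (e x) z < r] by apply/(mz_nbhs md); exists r.
move=> /(embedding_continuous ee) h.
by apply: (filterS _ (h : nbhs x _)) => y; exact: rU.
Qed.

(** Without a finite net, the sets of points [e]-far from finite sets generate a proper filter. A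
    cluster point [x] of it contradicts the set of points far from [x] itself. *)
Lemma compact_net (T : topologicalType) (d : T -> T -> R) (e : R) :
  metrizes d -> compact [set: T] -> 0 < e ->
  exists s : seq T, forall x, exists2 c, c \in s & d c x < e.
Proof.
move=> md cT e0; apply: contrapT => /forallNP ns.
pose far (s : seq T) := [set x | forall c, c \in s -> e <= d c x].
pose F : set_system T := filter_from setT far.
have FF : ProperFilter F.
  apply: filter_from_proper; last first.
    move=> s _; have /existsNP[x hx] := ns s; exists x => c cs.
    by rewrite leNgt; apply/negP => cx; apply: hx; exists c.
  apply: filter_from_filter; first by exists [::].
  move=> s t _ _; exists (s ++ t) => // x h.
  by split=> c cs; apply: h; rewrite mem_cat cs ?orbT.
have [|x [_ Fx]] := cT F FF; first by exists [::].
have [||y [/= h xy]] := Fx (far [:: x]) [set y | d x y < e].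
- by exists [:: x].
- by apply/(mz_nbhs md); exists e.
by have := h x (mem_head _ _); lra.
Qed.

(** The functions are the distances to the points of a countable dense set, the union of finite nets
    of mesh 1/(n+1). *)
Lemma compact_separating (X : topologicalType) :
  metrizable R X -> compact [set: X] ->
  exists w : nat -> X -> R, [/\ forall n, continuous (w n),
    forall n x, 0 <= w n x <= 1 & forall x y, (forall n, w n x = w n y) -> x = y].
Proof.
move=> /metrizable_metrizes[d md] cX.
have [[x0 _]|X0] := pselect (exists x : X, True); last first.
  exists (fun _ _ => 0); split=> [n x|n x|x]; first exact: cvg_cst.
    by rewrite lexx ler01.
  by case: X0; exists x.
have [n|s hs] := @seq_choice (seq X) (fun n s =>
    forall x, exists2 c, c \in s & d c x < n.+1%:R^-1).
  by apply: (compact_net md cX); exact: invS_gt0.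
(* All nets are enumerated at once by coding pairs (net, position); [x0] fills invalid codes and
   positions past the end. *)
pose c k := if unpickle k is Some (n, i) then nth x0 (s n) i else x0.
exists (fun k => d (c k)); split.
- move=> k; apply: (lipschitz_continuous md) => x y.
  by rewrite addrC (mz_sym md x); exact: mz_triangle.
- by move=> k x; rewrite (mz_ge0 md) (mz_le1 md).
move=> x y xy; apply: (mz_eq md); apply: le_anti; rewrite (mz_ge0 md) andbT.
rewrite leNgt; apply/negP => d0.
have [n /ltW hn] : exists n : nat, n.+1%:R^-1 < d x y / 2.
  have d2 : 0 < d x y / 2 by lra.
  have [N _ hN] := near_infty_natSinv_lt (PosNum d2).
  by exists N; exact: (hN N (leqnn N)).
have [z zs /lt_le_trans/(_ hn) zx] := hs n x.
have := xy (pickle (n, index z (s n))); rewrite /c pickleK nth_index// => zxy.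
have := mz_triangle md z x y; rewrite (mz_sym md x z) -zxy; lra.
Qed.

End compact.

(** * The Hilbert cube: metrizability, the AR property and Z-embeddings of compacta *)

Section hilbert_cube.
Variable R : realType.
Local Notation Q := (hilbert_cube R).

Definition qcoord (n : nat) (x : Q) : R := set_val (x n).

Definition qpoint (t : R) : set_type (@unit_itv R) :=
  exist _ (clamp t) (mem_set (unit_itv_clamp t)).

Lemma qcoord_qpoint (g : nat -> R) n :
  qcoord n (fun m => qpoint (g m)) = clamp (g n).
Proof. by []. Qed.

Lemma qcoord01 n x : 0 <= qcoord n x <= 1.
Proof. by have /unit_itvP := set_valP (x n). Qed.

Lemma qcoord_inj (x y : Q) : (forall n, qcoord n x = qcoord n y) -> x = y.
Proof.
by move=> xy; apply: functional_extensionality_dep => n; apply: val_inj; exact: xy.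
Qed.

Lemma qcoord_continuous n : continuous (qcoord n).
Proof.
move=> x; apply: (continuous_comp (f := fun x : Q => x n)).
  exact: (@proj_continuous _ (fun=> set_type (@unit_itv R)) n x).
exact: initial_continuous.
Qed.

Lemma qpoint_continuous : continuous qpoint.
Proof.
by apply: continuous_comp_initial => x; exact: (@clamp_continuous R x).
Qed.

Lemma continuous_cube (S : topologicalType) (f : S -> Q) :
  (forall n, continuous (qcoord n \o f)) -> continuous f.
Proof.
move=> cf x; apply/cvg_sup => i.
have ci : continuous (fun y => f y i : set_type (@unit_itv R)).
  by apply: continuous_comp_initial => y; exact: cf.
have : continuous (f : S -> initial_topology (fun g : Q => g i)).
  by apply: continuous_comp_initial => y; exact: ci.
exact.
Qed.

Lemma cube_hausdorff : hausdorff_space Q.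
Proof.
apply: hausdorff_product => n x y xy; apply: val_inj.
apply: (@norm_hausdorff _ R) => U V xU yV.
have [] := xy (set_val @^-1` U) (set_val @^-1` V).
- exact: (@initial_continuous _ _ (set_val : set_type (@unit_itv R) -> R) x U xU).
- exact: (@initial_continuous _ _ (set_val : set_type (@unit_itv R) -> R) y V yV).
by move=> z [Uz Vz]; exists (set_val z).
Qed.

Lemma compact_unit : compact [set: set_type (@unit_itv R)].
Proof.
rewrite (_ : setT = qpoint @` @unit_itv R).
  apply: continuous_compact; last exact: segment_compact.
  by apply: continuous_subspaceT; exact: qpoint_continuous.
apply/seteqP; split=> // x _; exists (set_val x); first exact: set_valP.
by apply: val_inj; rewrite /= clamp_id//; have /unit_itvP := set_valP x.
Qed.

Lemma compact_cube : compact [set: Q].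
Proof.
have := @tychonoff nat (fun=> set_type (@unit_itv R)) (fun=> setT) (fun=> compact_unit).
by congr compact; apply/seteqP.
Qed.

(** The weights 1/(n+1) make the sup distance compatible with the product topology. This embedding
    gives the metrizability of the cube and also feeds its points to [sup_space_extension]. *)
Definition cube_sup (x : Q) : sup_space 0%N (fun _ : nat -> R => True).
Proof.
apply: (@SupSpace R nat 0%N _ (fun n => qcoord n x / n.+1%:R)) => // n.
have /andP[x0 x1] := qcoord01 n x.
by rewrite divr_ge0//= ler_pdivrMr// mul1r (le_trans x1)// ler1n.
Defined.

(** Coordinates from [N] on contribute less than [e / 2] by their weights alone, so only finitely
    many have to be controlled. *)
Lemma cube_sup_continuous : continuous cube_sup.
Proof.
move=> x U /(mz_nbhs (metrizes_sup_dist _ _))[e e0 eU].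
have e2 : 0 < e / 2 by lra.
have [N _ hN] := near_infty_natSinv_lt (PosNum e2).
have near_coord m : nbhs x [set y | forall n, (n < m)%N ->
    `|qcoord n x - qcoord n y| < e / 2].
  elim: m => [|m IHm]; first by apply: filterS filterT.
  have xm : nbhs x [set y | `|qcoord m x - qcoord m y| < e / 2].
    have := @qcoord_continuous m x [set t | `|qcoord m x - t| < e / 2].
    by apply; exact: (nbhsx_ballx (qcoord m x) _ e2).
  apply: filterS2 IHm xm => y ym xym n; rewrite ltnS leq_eqVlt.
  by move=> /orP[/eqP ->//|]; exact: ym.
apply: (filterS _ (near_coord N)) => y hy; apply: eU.
apply: (@le_lt_trans _ _ (e / 2)); last lra.
apply: sup_dist_le => n /=; rewrite -mulrBl normrM (@ger0_norm _ _^-1)//.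
have n1 : n.+1%:R^-1 <= 1 :> R by rewrite invf_le1// ler1n.
have [nN|Nn] := ltnP n N.
  by apply: le_trans (ltW (hy n nN)); rewrite ler_piMr.
have hn : n.+1%:R^-1 < e / 2 := hN n Nn.
apply: le_trans (ltW hn); rewrite ler_piMl ?invr_ge0//.
by have := qcoord01 n x; have := qcoord01 n y; rewrite ler_norml; lra.
Qed.

Lemma cube_sup_inj : injective cube_sup.
Proof.
move=> x y xy; apply: qcoord_inj => n.
have /= := congr1 (fun g => sup_fun g n) xy.
by move/(congr1 ( *%R^~ n.+1%:R)); rewrite !divfK.
Qed.

Lemma cube_metrizable : metrizable R Q.
Proof.
apply: (embedding_metrizable (e := cube_sup)); last exact: sup_space_metrizable.
apply: (compact_embedding compact_cube _ cube_sup_continuous cube_sup_inj).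
exact: mz_hausdorff (metrizes_sup_dist _ _).
Qed.

Definition cube_space : metrizable_space R := MetrizableSpace cube_metrizable.

(** The weighted coordinates are extended by Hausdorff's formula; multiplying by n+1 undoes the
    weight and clamping returns to the cube. Continuity into the product is checked
    coordinatewise. *)
Lemma AE_cube : AE R Q.
Proof.
move=> Z A f cA cf; have [dZ mZ] := metrizable_metrizes (metrizableP Z).
have [A0|nA0] := pselect (A !=set0); last first.
  exists (fun=> fun=> qpoint 0); first by move=> z; exact: cvg_cst.
  by move=> z Az; case: nA0; exists z.
have cf' : {within A, continuous (cube_sup \o f)}.
  apply: (within_comp (B := setT) _ cf) => //.
  by apply: continuous_subspaceT; exact: cube_sup_continuous.
have [F [F01 FA Fcts]] := sup_space_extension mZ cA A0 cf'.
have cF n : continuous (F n).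
  apply: (mz_cts mZ (metrizes_R R)) => z e e0.
  have [|r r0 rF] := Fcts z (e / 2); first lra.
  exists r => // w /rF/(_ n) h; rewrite gt_min; apply/orP; left; lra.
exists (fun z n => qpoint (F n z * n.+1%:R)).
  apply: continuous_cube => n z.
  apply: (continuous_comp (f := fun z => F n z * n.+1%:R) _ (@clamp_continuous R _)).
  by apply: cvgMl; exact: cF.
move=> z Az; apply: qcoord_inj => n.
rewrite (qcoord_qpoint (fun n => F n z * n.+1%:R)) FA//= divfK// clamp_id//.
exact: qcoord01.
Qed.

Lemma AR_cube : is_AR cube_space.
Proof. exact: (@AE_AR R cube_space (fun=> qpoint 0) AE_cube). Qed.

Lemma compact_Zembedding (X : metrizable_space R) :
  compact [set: X] -> inhabited (Zembedding R X Q).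
Proof.
move=> cX; have [w [cw w01 wsep]] := compact_separating (metrizableP X) cX.
(* Coordinate 0 is reserved: it vanishes on the image, and increasing it is the homotopy that shows
   the image to be a Z-set. The separating functions occupy the others, shifted by one. *)
pose e (x : X) : Q := fun n => qpoint (if n is k.+1 then w k x else 0).
have eE n x : qcoord n (e x) = if n is k.+1 then w k x else 0.
  by rewrite /e qcoord_qpoint clamp_id//; case: n => [|n] //; rewrite lexx ler01.
have ce : continuous e.
  apply: continuous_cube => -[|n] x.
    rewrite (_ : _ \o _ = fun=> 0); first exact: cvg_cst.
    by apply/funext => y /=; rewrite eE.
  rewrite (_ : _ \o _ = w n); first exact: cw.
  by apply/funext => y /=; rewrite eE.
have ie : injective e.
  by move=> x y exy; apply: wsep => n; rewrite -(eE n.+1 x) -(eE n.+1 y) exy.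
have ee := compact_embedding cX cube_hausdorff ce ie.
constructor; apply: (ZEmbedding ee); split.
  exact: compact_range cX cube_hausdorff ce.
pose g (p : Q * R) n := if n is k.+1 then qcoord n p.1 else qcoord 0 p.1 + clamp p.2.
exists (fun p n => qpoint (g p n)); split.
- apply: continuous_subspaceT; apply: continuous_cube => n.
  have cg : continuous (fun p => g p n).
    have cq m : continuous (qcoord m \o @fst Q R).
      by move=> p; apply: continuous_comp; [exact: cvg_fst|exact: qcoord_continuous].
    case: n => [|n] p; last exact: cq.
    apply: cvgD; first exact: cq.
    exact: (continuous_comp cvg_snd (@clamp_continuous R _)).
  move=> p; exact: (continuous_comp (cg p) (@clamp_continuous R _)).
- move=> x; apply: qcoord_inj => n; rewrite qcoord_qpoint.
  have clamp0 : clamp 0 = 0 :> R by rewrite clamp_id// lexx ler01.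
  by case: n => [|n] /=; rewrite ?clamp0 ?addr0 clamp_id//; exact: qcoord01.
- move=> x t /andP[t0 _] [y _ /(congr1 (qcoord 0))]; rewrite qcoord_qpoint eE /=.
  move=> h; have : 0 < clamp (qcoord 0 x + clamp t).
    by apply: clamp_gt0; apply: ltr_wpDl; [case/andP: (qcoord01 0 x)|exact: clamp_gt0].
  by rewrite -h ltxx.
Qed.

End hilbert_cube.

(** * Comparison of fine shape and strong shape for compacta *)

Section strong_shape.
Variable R : realType.
Local Notation Q := (hilbert_cube R).

Definition cube_AR (X : Zcompactum R) : AR_Zembedding R X :=
  @ARZEmbedding R X (cube_space R) (@AR_cube R) (zc_zemb X).

Section maps.
Variables X Y : Zcompactum R.

Let cY : closed (range (zc_zemb Y)).
Proof. by case: (zemb_Zset (zc_zemb Y)). Qed.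

Lemma proper_approaching_map f :
  Defs.proper (zc_compl X) (range (zc_zemb Y)) f <->
  approaching (~` range (cube_AR X)) (range (cube_AR X)) (range (cube_AR Y)) f.
Proof.
apply: (@proper_approachingP R Q Q (zc_compl X) (range (zc_zemb X)) _ f
  (cube_metrizable R) (cube_metrizable R) (@compact_cube R) cY).
  by rewrite setUC setUv; exact: compact_cube.
by move=> x.
Qed.

Lemma proper_approaching_homotopy h :
  Defs.proper (zc_compl X `*` @unit_itv R) (range (zc_zemb Y)) h <->
  approaching (~` range (cube_AR X) `*` @unit_itv R)
    (range (cube_AR X) `*` @unit_itv R) (range (cube_AR Y)) h.
Proof.
apply: (@proper_approachingP R (Q * R)%type Q (zc_compl X `*` @unit_itv R)
  (range (zc_zemb X) `*` @unit_itv R) _ h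
  (metrizable_prod (cube_metrizable R) (metrizable_R R))
  (cube_metrizable R) (@compact_cube R) cY).
  have -> : (zc_compl X `*` @unit_itv R) `|` (range (cube_AR X) `*` @unit_itv R) =
      setT `*` @unit_itv R.
    apply/seteqP; split=> [p [[_ ?]|[_ ?]]|[x t] [/= _ It]]; [by []..|].
    by have [Xx|Xx] := pselect (range (zc_zemb X) x); [right|left].
  by apply: compact_setX; [exact: compact_cube|exact: segment_compact].
by move=> p [/= nX _] [].
Qed.

Definition proper_of (f : approaching_map (cube_AR X) (cube_AR Y)) :
  proper_map X Y := ProperMap ((proper_approaching_map f).2 (amapP f)).

Definition approaching_of (f : proper_map X Y) :
  approaching_map (cube_AR X) (cube_AR Y) :=
  ApproachingMap ((proper_approaching_map f).1 (pmapP f)).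

Lemma proper_homotopicP (f g : proper_map X Y) : proper_homotopic f g <->
  approaching_homotopic (approaching_of f) (approaching_of g).
Proof.
by split=> -[h [/proper_approaching_homotopy ah h0 h1]]; exists h.
Qed.

Lemma strong_shape_classP (f g : proper_map X Y) :
  strong_shape_class f = strong_shape_class g <->
  approaching_homotopic (approaching_of f) (approaching_of g).
Proof.
rewrite -proper_homotopicP; apply: class_eqP.
- by move=> k; apply/proper_homotopicP; exact: ah_refl.
- by move=> k l /proper_homotopicP h; apply/proper_homotopicP; exact: ah_sym.
- move=> k l m /proper_homotopicP h /proper_homotopicP h'.
  by apply/proper_homotopicP; exact: ah_trans h h'.
Qed.

Lemma strong_shape_hom_ex (p : strong_shape_hom X Y) :
  exists f, p = strong_shape_class f.
Proof. exact: classP. Qed.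

Definition strong_shape_repr (p : strong_shape_hom X Y) : proper_map X Y :=
  projT1 (cid (strong_shape_hom_ex p)).

Lemma strong_shape_reprK p : strong_shape_class (strong_shape_repr p) = p.
Proof. by rewrite /strong_shape_repr; case: cid => /= f ->. Qed.

(** Every fine shape morphism has a representative between the complements in the Hilbert cube, and
    there approaching maps and homotopies are the proper ones. *)
Definition fish_to_strong_shape (p : fish_hom X Y) : strong_shape_hom X Y :=
  strong_shape_class (proper_of (fish_repr p (cube_AR X) (cube_AR Y))).

Lemma fish_to_strong_shape_class (f : approaching_map (cube_AR X) (cube_AR Y)) :
  fish_to_strong_shape (fish_class f) = strong_shape_class (proper_of f).
Proof.
apply/strong_shape_classP.
suff : approaching_homotopic (fish_repr (fish_class f) (cube_AR X) (cube_AR Y)) f by [].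
by apply/fish_class_homotopicP; rewrite fish_reprK.
Qed.

Lemma fish_to_strong_shape_bijective : bijective fish_to_strong_shape.
Proof.
exists (fun q => fish_class (approaching_of (strong_shape_repr q))) => [p|q].
  have [f ->] := fish_hom_ex p (cube_AR X) (cube_AR Y).
  rewrite fish_to_strong_shape_class; apply/fish_class_homotopicP.
  set k := strong_shape_repr _.
  have : approaching_homotopic (approaching_of k) (approaching_of (proper_of f)).
    by apply/strong_shape_classP; rewrite strong_shape_reprK.
  by [].
rewrite fish_to_strong_shape_class -[RHS]strong_shape_reprK.
exact/strong_shape_classP/ah_refl.
Qed.

End maps.

Definition strong_shape_comp (X Y Z : Zcompactum R) (q : strong_shape_hom Y Z)
    (p : strong_shape_hom X Y) : strong_shape_hom X Z :=
  strong_shape_class (pmap_comp (strong_shape_repr q) (strong_shape_repr p)).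

Lemma strong_shape_comp_class (X Y Z : Zcompactum R) (g : proper_map Y Z)
    (f : proper_map X Y) :
  strong_shape_comp (strong_shape_class g) (strong_shape_class f) =
  strong_shape_class (pmap_comp g f).
Proof.
rewrite /strong_shape_comp; set g0 := strong_shape_repr _; set f0 := strong_shape_repr _.
have hf : approaching_homotopic (approaching_of f0) (approaching_of f).
  by apply/strong_shape_classP; rewrite strong_shape_reprK.
have hg : approaching_homotopic (approaching_of g0) (approaching_of g).
  by apply/strong_shape_classP; rewrite strong_shape_reprK.
apply/strong_shape_classP.
exact: (ah_trans (ah_compr (approaching_of f0) hg) (ah_compl (approaching_of g) hf)).
Qed.

Definition strong_shape_category_on : category_on (@strong_shape_hom R).
Proof.
refine (@Category _ _ (fun X => strong_shape_class (pmap_id X))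
  strong_shape_comp _ _ _).
- move=> X Y p; have [f ->] := strong_shape_hom_ex p.
  by rewrite strong_shape_comp_class; exact/strong_shape_classP/ah_refl.
- move=> X Y p; have [f ->] := strong_shape_hom_ex p.
  by rewrite strong_shape_comp_class; exact/strong_shape_classP/ah_refl.
- move=> W X Y Z r q p; have [h ->] := strong_shape_hom_ex r.
  have [g ->] := strong_shape_hom_ex q; have [f ->] := strong_shape_hom_ex p.
  by rewrite !strong_shape_comp_class; exact/strong_shape_classP/ah_refl.
Defined.

Definition strong_shape_cat : strong_shape_category R :=
  @StrongShapeCategory R strong_shape_category_on (fun=> erefl)
    strong_shape_comp_class.

Lemma fish_to_strong_shape_functorial :
  functorial (pullback_cat (@zc_space R) (fish_category R)) strong_shape_cat
    fish_to_strong_shape.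
Proof.
split=> [X|X Y Z q p] /=.
  rewrite (fish_id_class (cube_AR X)) fish_to_strong_shape_class.
  exact/strong_shape_classP/ah_refl.
have [g ->] := fish_hom_ex q (cube_AR Y) (cube_AR Z).
have [f ->] := fish_hom_ex p (cube_AR X) (cube_AR Y).
rewrite fish_comp_class !fish_to_strong_shape_class strong_shape_comp_class.
exact/strong_shape_classP/ah_refl.
Qed.

End strong_shape.

Theorem theorem2 (R : realType) :
  exists (HO : homotopy_category R) (FISH : fine_shape_category R)
         (SSH : strong_shape_category R),
    (* (a) and (b) *)
    (exists F : forall X Y : metrizable_space R, htpy_hom X Y -> fish_hom X Y,
      [/\ functorial HO FISH F,
          (forall (X Y : metrizable_space R) (phi : continuousType X Y)
              (M : AR_Zembedding R X) (N : AR_Zembedding R Y),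
             (exists f : approaching_map M N, combines phi f) /\
             (forall f : approaching_map M N, combines phi f ->
                F X Y (htpy_class phi) = fish_class f)) &
          (forall X Y : metrizable_space R,
             is_ANR X -> is_ANR Y -> bijective (F X Y))]) /\
    (* (c) *)
    ((forall X : metrizable_space R, compact [set: X] ->
        inhabited (Zembedding R X (hilbert_cube R))) /\
     exists B : forall X Y : Zcompactum R,
         fish_hom X Y -> strong_shape_hom X Y,
       (forall X Y : Zcompactum R, bijective (B X Y)) /\
       functorial (pullback_cat (@zc_space R) FISH) SSH B).
Proof.
exists (homotopy_cat R), (fish_category R), (strong_shape_cat R); split.
  exists (@fish_functor R); split.
  - exact: fish_functor_functorial.
  - move=> X Y phi M N; split; first exact/combines_ex/cts_fun.
    by move=> f; exact: fish_functor_class.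
  - by move=> X Y _; exact: fish_functor_bijective.
split; first exact: compact_Zembedding.
exists (@fish_to_strong_shape R); split; first exact: fish_to_strong_shape_bijective.
exact: fish_to_strong_shape_functorial.
Qed.
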